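(* For a Coxeter type $X_n$, let $f_X(n)$ denote the number of content maximal elements in the Coxeter group of type $X_n$. Then the ordinary generating functions for the numbers of content maximal elements in types $A_n$ ($n\ge 1$), $D_n$ ($n\ge 4$) and $E_n$ ($n\ge 6$) are, respectively, $$\sum_{n\ge 1} f_A(n)\,x^n = \frac{2x-x^3}{1-3x-x^2+x^3} = 2x+6x^2+19x^3+61x^4+196x^5+\cdots,$$ $$\sum_{n\ge 4} f_D(n)\,x^n = \frac{62x^4+15x^5-19x^6}{1-3x-x^2+x^3} = 62x^4+201x^5+646x^6+2077x^7+\cdots,$$ $$\sum_{n\ge 6} f_E(n)\,x^n = \frac{652x^6+140x^7-201x^8}{1-3x-x^2+x^3} = 652x^6+2096x^7+6739x^8+\cdots.$$
   Context: Types: the Coxeter graph of type $A_n$ is a path with $n$ vertices; that of type $D_n$ is a path with $n-1$ vertices together with one additional vertex joined to the second vertex from one end; that of type $E_n$ is a path with $n-1$ vertices together with one additional vertex joined to the third vertex from one end. In the $E$-series $n$ is allowed to be any integer $\ge 6$ (the groups are infinite for $n\ge 9$). In each case $m_{ij}=3$ for adjacent $i\ne j$ and $m_{ij}=2$ for non-adjacent $i\neq j$. Let $W$ be a simply laced Coxeter group (that is, $m_{ij}\in\{2,3\}$ for $i\ne j$) with distinguished generators $S=\{s_i : i\in I\}$ and Coxeter matrix $(m_{ij})_{i,j\in I}$. Words: $I^*$ is the free monoid on $I$, and $\phi: I^*\to W$ is the monoid morphism with $\phi(i)=s_i$. A word represents its image under $\phi$. A word of minimal length among those representing $w$ is a reduced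 expression for $w$; its length is $\ell(w)$. The support $\mathrm{supp}(w)$ is the set of letters of $I$ appearing in some (equivalently, any) reduced expression for $w$. Roots: $V$ is the real vector space with basis $\{\alpha_i : i\in I\}$ with the symmetric bilinear form (Coxeter form) $B(\alpha_i,\alpha_j) = -\cos(\pi/m_{ij})$, and $W$ acts on $V$ by $s_i\alpha_j = \alpha_j - 2B(\alpha_j,\alpha_i)\alpha_i$. The root system is $\Phi=\{w\alpha_i : w\in W, i\in I\}$; $\Phi^+$ is the set of roots that are linear combinations of the $\alpha_i$ with nonnegative coefficients, and $\Phi^-=-\Phi^+$. The inversion set of $w$ is $\Phi(w)=\Phi^+\cap w^{-1}(\Phi^-)$. Root sequences: given a reduced expression $i_1i_2\cdots i_n$ for $w$, its root sequence is $(r_1,\dots,r_n)$, where $r_1=\alpha_{i_n}$ and $r_l=s_{i_n}\cdots s_{i_{n-l+2}}(\alpha_{i_{n-l+1}})$ for $2\le l\le n$; its entries are exactly the elements of $\Phi(w)$. It is called a root sequence for $w$. Inversion triples: an inversion triple of $w$ is a subset of $\Phi(w)$ of the form $\{\alpha,\beta,\alpha+\beta\}$. An inversion triple $T$ of $w$ is contractible if there is a root sequence for $w$ in which the elements of $T$ appear consecutively (in some order). $N(w)$ is the number of contractible inversion triples of $w$. The element $w$ is freely braided if its contractible inversion triples are pairwise disjoint. Content maximal: a freely braided element $w$ is content maximal if $\#\mathrm{supp}(w)=\ell(w)-N(w)$. *)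

(* Defs.v *)
From HB Require Import structures.
From mathcomp Require Import all_boot all_order all_algebra.
From mathcomp Require Import all_classical all_reals all_analysis.
From mathcomp Require Import finmap ring lra.

Set Implicit Arguments.
Unset Strict Implicit.
Unset Printing Implicit Defensive.

Import Order.TTheory GRing.Theory Num.Theory.

Local Open Scope quotient_scope.
Local Open Scope classical_set_scope.
Local Open Scope ring_scope.

Record coxgraph (n : nat) := CoxGraph {
  adj :> rel 'I_n;
  adj_sym : symmetric adj;
  adj_irr : irreflexive adj }.

Definition coxm n (G : coxgraph n) (i j : 'I_n) : nat :=
  (if i == j then 1 else if G i j then 3 else 2)%N.

Lemma coxmC n (G : coxgraph n) i j : coxm G i j = coxm G j i.
Proof. by rewrite /coxm eq_sym adj_sym. Qed.

Section OfEdges.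
Variables (e : rel nat) (e_irr : irreflexive e) (n : nat).

Definition edge_adj (i j : 'I_n) := e i j || e j i.

Fact edge_adj_sym : symmetric edge_adj.
Proof. by move=> i j; rewrite /edge_adj orbC. Qed.

Fact edge_adj_irr : irreflexive edge_adj.
Proof. by move=> i; rewrite /edge_adj e_irr. Qed.

Definition edge_graph := CoxGraph edge_adj_sym edge_adj_irr.
End OfEdges.

Definition edgeA : rel nat := fun i j => j == i.+1.

(* The path is 1, 2, ..., n-1 and the additional vertex is 0, joined to the *)
(* b-th vertex of the path.                                                 *)
Definition edge_branch (b : nat) : rel nat :=
  fun i j => (if i == 0 then j == b else j == i.+1)%N.

Fact edgeA_irr : irreflexive edgeA.
Proof. by move=> i; rewrite /edgeA ltn_eqF. Qed.

Fact edge_branch_irr b : (0 < b)%N -> irreflexive (edge_branch b).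
Proof.
by case: b => // b _ [|i] //; rewrite /edge_branch /= ltn_eqF.
Qed.

Definition graphA (n : nat) : coxgraph n := edge_graph edgeA_irr n.
Definition graphD (n : nat) : coxgraph n := edge_graph (@edge_branch_irr 2 isT) n.
Definition graphE (n : nat) : coxgraph n := edge_graph (@edge_branch_irr 3 isT) n.

Inductive coxcong n (G : coxgraph n) : seq 'I_n -> seq 'I_n -> Prop :=
| coxcong_refl u : coxcong G u u
| coxcong_sym u v : coxcong G u v -> coxcong G v u
| coxcong_trans v u w : coxcong G u v -> coxcong G v w -> coxcong G u w
| coxcong_ctx a b u v :
    coxcong G u v -> coxcong G (a ++ u ++ b) (a ++ v ++ b)
| coxcong_rel i j :
    coxcong G (flatten (nseq (coxm G i j) [:: i; j])) [::].

Section CoxeterGroup.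
Variables (n : nat) (G : coxgraph n).

Lemma coxcong_cat u u' v v' :
  coxcong G u u' -> coxcong G v v' -> coxcong G (u ++ v) (u' ++ v').
Proof.
move=> uu' vv'; apply: (@coxcong_trans _ _ (u' ++ v)).
  exact: (@coxcong_ctx _ _ [::] v).
by have := @coxcong_ctx _ _ u' [::] _ _ vv'; rewrite !cats0.
Qed.

Lemma coxcong_rev u v : coxcong G u v -> coxcong G (rev u) (rev v).
Proof.
elim=> {u v} [u|u v _|v u w _ IH _|a b u v _ IH|i j].
- exact: coxcong_refl.
- exact: coxcong_sym.
- exact: coxcong_trans.
- by rewrite !rev_cat -!catA; apply: coxcong_ctx.
- suff -> : rev (flatten (nseq (coxm G i j) [:: i; j])) =
            flatten (nseq (coxm G j i) [:: j; i]) by exact: coxcong_rel.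
  by rewrite rev_flatten map_nseq rev_nseq coxmC.
Qed.

Lemma coxcong_revV u : coxcong G (rev u ++ u) [::].
Proof.
elim: u => [|i u IH]; first exact: coxcong_refl.
rewrite rev_cons cat_rcons -[i :: i :: u]/([:: i; i] ++ u).
apply: coxcong_trans IH; rewrite -[X in coxcong _ _ (_ ++ X)]cat0s.
apply: coxcong_ctx; have := coxcong_rel G i i.
by rewrite /coxm eqxx.
Qed.

Definition coxcongb : rel (seq 'I_n) := fun u v => `[< coxcong G u v >].

Fact coxcongb_equiv : equiv_class_of coxcongb.
Proof.
split=> [u|u v|v u w]; first by apply/asboolP; apply: coxcong_refl.
  by apply/asboolP/asboolP; apply: coxcong_sym.
by move=> /asboolP uv /asboolP vw; apply/asboolP; apply: coxcong_trans vw.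
Qed.

Canonical coxcong_equiv := EquivRelPack coxcongb_equiv.

Definition coxgroup := {eq_quot coxcong_equiv}.
HB.instance Definition _ := Choice.on coxgroup.
HB.instance Definition _ := EqQuotient.on coxgroup.

Lemma coxgroup_eqP u v :
  \pi_coxgroup u = \pi_coxgroup v <-> coxcong G u v.
Proof. by split => [/eqquotP/asboolP //|uv]; apply/eqquotP/asboolP. Qed.

Lemma coxgroup_ind (P : coxgroup -> Prop) :
  (forall u, P (\pi_coxgroup u)) -> forall x, P x.
Proof. by move=> Ppi x; rewrite -[x]reprK. Qed.

Lemma repr_pi u : coxcong G (repr (\pi_coxgroup u)) u.
Proof. by apply/coxgroup_eqP; rewrite reprK. Qed.

Definition cox_one : coxgroup := \pi_coxgroup [::].
Definition cox_mul (x y : coxgroup) : coxgroup := \pi_coxgroup (repr x ++ repr y).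
Definition cox_inv (x : coxgroup) : coxgroup := \pi_coxgroup (rev (repr x)).

Lemma cox_mul_pi u v : cox_mul (\pi_coxgroup u) (\pi_coxgroup v) = \pi_coxgroup (u ++ v).
Proof. by apply/coxgroup_eqP/coxcong_cat; apply: repr_pi. Qed.

Lemma cox_inv_pi u : cox_inv (\pi_coxgroup u) = \pi_coxgroup (rev u).
Proof. by apply/coxgroup_eqP/coxcong_rev/repr_pi. Qed.

Fact cox_mulA : associative cox_mul.
Proof.
by elim/coxgroup_ind=> u; elim/coxgroup_ind=> v; elim/coxgroup_ind=> w; rewrite !cox_mul_pi catA.
Qed.

Fact cox_mul1 : left_id cox_one cox_mul.
Proof. by elim/coxgroup_ind=> u; rewrite cox_mul_pi. Qed.

Fact cox_mulr1 : right_id cox_one cox_mul.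
Proof. by elim/coxgroup_ind=> u; rewrite cox_mul_pi cats0. Qed.

Fact cox_mulV : left_inverse cox_one cox_inv cox_mul.
Proof.
elim/coxgroup_ind=> u; rewrite cox_inv_pi cox_mul_pi.
by apply/coxgroup_eqP; apply: coxcong_revV.
Qed.

Fact cox_mulrV : right_inverse cox_one cox_inv cox_mul.
Proof.
elim/coxgroup_ind=> u; rewrite cox_inv_pi cox_mul_pi.
by apply/coxgroup_eqP; have := coxcong_revV (rev u); rewrite revK.
Qed.

HB.instance Definition _ := isGroup.Build coxgroup
  cox_mulA cox_mul1 cox_mulr1 cox_mulV cox_mulrV.

Definition cox_gen (i : 'I_n) : coxgroup := \pi_coxgroup [:: i].

Definition cox_word (u : seq 'I_n) : coxgroup :=
  (\prod_(i <- u) cox_gen i)%g.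

Lemma cox_wordE u : cox_word u = \pi_coxgroup u.
Proof.
rewrite /cox_word; elim: u => [|i u IH]; first by rewrite big_nil.
by rewrite big_cons IH [LHS]cox_mul_pi.
Qed.

Lemma cox_word_surj (w : coxgroup) : exists u, cox_word u = w.
Proof. by exists (repr w); rewrite cox_wordE reprK. Qed.

Definition represents (u : seq 'I_n) (w : coxgroup) : Prop := cox_word u = w.

Fact cox_length_ex (w : coxgroup) :
  exists k, `[< exists2 u, represents u w & size u = k >].
Proof.
by have [u uw] := cox_word_surj w; exists (size u); apply/asboolP; exists u.
Qed.

Definition cox_length (w : coxgroup) : nat := ex_minn (cox_length_ex w).

Definition reduced (u : seq 'I_n) (w : coxgroup) : Prop :=
  represents u w /\ size u = cox_length w.

Definition cox_supp (w : coxgroup) : {set 'I_n} :=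
  [set i | `[< exists2 u, reduced u w & i \in u >]]%SET.

End CoxeterGroup.

Section Roots.
Variables (R : realType) (n : nat) (G : coxgraph n).
Local Notation W := (coxgroup G).
Local Notation V := 'rV[R]_n.

Definition simple_root (i : 'I_n) : V := delta_mx 0 i.

Definition cox_form (u v : V) : R :=
  \sum_i \sum_j u 0 i * v 0 j * - cos (pi / (coxm G i j)%:R).

Definition refl (i : 'I_n) (v : V) : V :=
  v - (2 * cox_form v (simple_root i)) *: simple_root i.

Definition word_act (u : seq 'I_n) (v : V) : V := foldr refl v u.

(* Independent of the chosen representative word: see cox_act_word. *)
Definition cox_act (w : W) (v : V) : V := word_act (repr w) v.

Let sr := simple_root.

Lemma cos_pi3 : cos (pi / 3 : R) = 1 / 2.
Proof.
set x : R := pi / 3; have pi_gt0 := pi_gt0 R.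
have c0 : 0 < cos x by apply: cos_gt0_pihalf; rewrite /x; lra.
have cpi : cos (x + x + x) = -1 :> R.
  by rewrite -cospi; congr cos; rewrite /x; field.
rewrite 2!cosD sinD in cpi; have sc := cos2Dsin2 x.
have : (cos x + 1) * (2 * cos x - 1) ^+ 2 = 0.
  have s2 : sin x ^+ 2 = 1 - cos x ^+ 2 by rewrite -sc; ring.
  have c3 : cos x ^+ 3 - 3 * cos x * sin x ^+ 2 = -1 by rewrite -cpi; ring.
  rewrite s2 in c3; rewrite -(subrr (-1 : R)) -[X in _ = X - _]c3; ring.
move=> /eqP; rewrite mulf_eq0 sqrf_eq0 => /orP[/eqP|/eqP]; lra.
Qed.

Lemma cox_formDl u v w : cox_form (u + v) w = cox_form u w + cox_form v w.
Proof.
rewrite /cox_form -big_split; apply: eq_bigr => i _.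
by rewrite -big_split; apply: eq_bigr => j _; rewrite mxE /=; ring.
Qed.

Lemma cox_formZl a u w : cox_form (a *: u) w = a * cox_form u w.
Proof.
rewrite /cox_form mulr_sumr; apply: eq_bigr => i _.
by rewrite mulr_sumr; apply: eq_bigr => j _; rewrite mxE; ring.
Qed.

Lemma cox_form_simple i j : cox_form (sr i) (sr j) = - cos (pi / (coxm G i j)%:R).
Proof.
rewrite /cox_form (bigD1 i) //= addrC big1 ?add0r => [|k /negPf ki].
  rewrite (bigD1 j) //= addrC big1 ?add0r => [|l /negPf lj].
    by rewrite !mxE !eqxx !mul1r.
  by rewrite !mxE lj andbF mulr0 mul0r.
by rewrite big1 // => l _; rewrite !mxE ki andbF !mul0r.
Qed.

Lemma cox_form_diag i : cox_form (sr i) (sr i) = 1.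
Proof. by rewrite cox_form_simple /coxm eqxx divr1 cospi opprK. Qed.

Lemma cox_form_off i j : i != j ->
  cox_form (sr i) (sr j) = if G i j then - (1 / 2) else 0.
Proof.
move=> /negPf ij; rewrite cox_form_simple /coxm ij.
by case: (G i j); rewrite ?cos_pi3 // cos_pihalf oppr0.
Qed.

Lemma refl_lin i v a b j : refl i (v + a *: sr i + b *: sr j) =
  v + (- a - 2 * cox_form v (sr i) - 2 * b * cox_form (sr j) (sr i)) *: sr i
  + b *: sr j.
Proof.
rewrite /refl -/sr !cox_formDl !cox_formZl cox_form_diag.
by apply/rowP => k; rewrite !mxE; ring.
Qed.

Lemma refl_linr i v a b j : refl i (v + b *: sr j + a *: sr i) =
  v + b *: sr j
  + (- a - 2 * cox_form v (sr i) - 2 * b * cox_form (sr j) (sr i)) *: sr i.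
Proof. by rewrite ![_ + _ + _ *: sr i]addrAC refl_lin. Qed.

Lemma word_act_cat u v x : word_act (u ++ v) x = word_act u (word_act v x).
Proof. exact: foldr_cat. Qed.

Lemma word_act_rel i j v :
  word_act (flatten (nseq (coxm G i j) [:: i; j])) v = v.
Proof.
have [<-|ij] := eqVneq i j.
  have E : v = v + 0 *: sr i + 0 *: sr i by rewrite !scale0r !addr0.
  rewrite /coxm eqxx [X in word_act _ X]E /= !refl_lin cox_form_diag.
  by apply/rowP => k; rewrite !mxE; ring.
have E : v = v + 0 *: sr i + 0 *: sr j by rewrite !scale0r !addr0.
have ji : j != i by rewrite eq_sym.
have := cox_form_off ij; have := cox_form_off ji; rewrite (adj_sym G j i).
rewrite /coxm (negPf ij) {1}E.
by case: (G i j) => hji hij /=; rewrite !(refl_lin, refl_linr) hij hji;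
  apply/rowP => k; rewrite !mxE; field.
Qed.

Lemma word_act_cong u v x : coxcong G u v -> word_act u x = word_act v x.
Proof.
move=> uv; elim: uv x => {u v} [|u v _ IH x|v u w _ IH _ IH' x|a b u v _ IH x|i j x] //.
- by rewrite IH IH'.
- by rewrite !word_act_cat IH.
- by rewrite word_act_rel.
Qed.

Lemma cox_act_word u v : cox_act (cox_word G u) v = word_act u v.
Proof. by rewrite cox_wordE; apply/word_act_cong/repr_pi. Qed.

Lemma cox_act1 v : cox_act 1%g v = v.
Proof. by rewrite -[v in RHS]/(word_act [::] v) -cox_act_word /cox_word big_nil. Qed.

Lemma cox_actM x y v : cox_act (x * y)%g v = cox_act x (cox_act y v).
Proof.
have [a <-] := cox_word_surj x; have [b <-] := cox_word_surj y.
have -> : (cox_word G a * cox_word G b)%g = cox_word G (a ++ b).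
  by rewrite /cox_word big_cat.
by rewrite !cox_act_word word_act_cat.
Qed.

Lemma cox_act_gen i v : cox_act (cox_gen G i) v = refl i v.
Proof.
rewrite -[refl i v]/(word_act [:: i] v) -cox_act_word.
by rewrite /cox_word big_seq1.
Qed.

Definition roots : set V := [set v | exists w i, v = cox_act w (simple_root i)].

Definition pos_roots : set V := roots `&` [set v | forall i, 0 <= v 0 i].

Definition neg_roots : set V := [set - v | v in pos_roots].

Definition inversions (w : W) : set V :=
  pos_roots `&` [set cox_act w^-1%g v | v in neg_roots].

(* With rev u = (i_n, ..., i_1), the entry at position k, counted from 0, is *)
(* s_{i_n} ... s_{i_{n-k+1}} (alpha_{i_{n-k}}).                              *)
Definition root_seq (u : seq 'I_n) : seq V :=
  [seq cox_act (cox_word G (take ki.1 (rev u))) (simple_root ki.2)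
     | ki <- zip (iota 0 (size u)) (rev u)].

Definition inversion_triple (w : W) (T : set V) : Prop :=
  T `<=` inversions w /\ exists a b, T = [set a; b; a + b].

Definition contractible (w : W) (T : set V) : Prop :=
  inversion_triple w T /\
  exists2 u, reduced u w &
    exists p q a b c, root_seq u = p ++ [:: a; b; c] ++ q /\ T = [set a; b; c].

Definition ncontractible (w : W) : nat :=
  #|` fset_set [set T | contractible w T]|%fset.

Definition freely_braided (w : W) : Prop :=
  trivIset [set T | contractible w T] id.

Definition content_maximal (w : W) : Prop :=
  freely_braided w /\
  (#|cox_supp w|%:Z = (cox_length w)%:Z - (ncontractible w)%:Z).

End Roots.

Definition content_maximal_set (R : realType) n (G : coxgraph n) :
  set (coxgroup G) := [set w | content_maximal R w].
Arguments content_maximal_set R {n} G.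

(* The cardinal of a finite set; fset_set sends an infinite set to fset0. *)
Definition ncontent_maximal (R : realType) n (G : coxgraph n) : nat :=
  #|` fset_set (content_maximal_set R G)|%fset.
Arguments ncontent_maximal R {n} G.

(* sum_(n >= n0) f n x^n *)
Definition ogf (n0 : nat) (f : nat -> nat) : nat -> int :=
  fun n => if (n0 <= n)%N then (f n)%:Z else 0.

Section FpsQuotient.
Variables (K : comUnitRingType) (P Q : {poly K}).

Fixpoint fps_quo_prefix (n : nat) : seq K :=
  if n is m.+1 then
    let s := fps_quo_prefix m in
    rcons s ((Q`_0)^-1 * (P`_m - \sum_(k < m) Q`_(m - k) * s`_k))
  else [::].

(* The quotient P / Q in K[[x]], computed by long division; it is           *)
(* characterized by fps_quoP.                                               *)
Definition fps_quo (n : nat) : K := (fps_quo_prefix n.+1)`_n.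

Lemma size_fps_quo_prefix n : size (fps_quo_prefix n) = n.
Proof. by elim: n => //= n IH; rewrite size_rcons IH. Qed.

Lemma nth_fps_quo_prefix n k : (k < n)%N -> (fps_quo_prefix n)`_k = fps_quo k.
Proof.
elim: n => // n IH; rewrite ltnS leq_eqVlt => /orP[/eqP->//|kn].
by rewrite /= nth_rcons size_fps_quo_prefix kn IH.
Qed.

Lemma fps_quo_rec n :
  fps_quo n = (Q`_0)^-1 * (P`_n - \sum_(k < n) Q`_(n - k) * fps_quo k).
Proof.
rewrite {1}/fps_quo /= nth_rcons size_fps_quo_prefix ltnn eqxx.
by congr (_ * (_ - _)); apply: eq_bigr => k _; rewrite nth_fps_quo_prefix.
Qed.

Lemma fps_quoP (f : nat -> K) : Q`_0 \is a GRing.unit ->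
  f =1 fps_quo <-> forall n, \sum_(k < n.+1) Q`_(n - k) * f k = P`_n.
Proof.
move=> Qu; split=> [fE n|fE].
  rewrite big_ord_recr /= subnn fE fps_quo_rec mulVKr //.
  by under eq_bigr do rewrite fE; rewrite addrC subrK.
elim/ltn_ind=> n IH; rewrite fps_quo_rec -fE big_ord_recr /= subnn.
under [X in _ - X]eq_bigr => k _ do rewrite -IH //.
by rewrite addrAC subrr add0r mulKr.
Qed.

End FpsQuotient.

(* Main.v *)
Require Import Defs.
From mathcomp Require Import all_boot all_order all_algebra.
From mathcomp Require Import all_classical all_reals all_analysis.
From mathcomp Require Import finmap zify ring lra.

(** A content maximal element is a product of blocks with pairwise disjoint
supports, where a block is a single letter or a long braid iji on two adjacent
letters.  Recording which letters occur, which edges carry a long braid, and,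
for each other edge between occurring letters, which of its two ends comes
first determines the element; on a forest every such record is realised,
provided that the edges carrying braids form a matching.  Counting records by
adding one leaf at a time gives the linear recurrence behind the three
generating functions.

The blocks are read off words.  In a word, [matched] says that the occurrences
of two adjacent letters interlace as iji or jij, and a word is [good] when
matched pairs are disjoint, carry three letters each, and all other letters
occur at most once.  Goodness and the matching are invariant under
commutations and braid moves ([good_braid_eq]), and a good word has no factor
ii.  By the word theorems of Tits and Matsumoto ([nonreduced_braid_eq],
[matsumoto]), which are derived here from the geometric representation, good
words are reduced and all reduced words of their element are good.

If an element has a good word, its contractible triples are the sets of roots
labelled by the matched pairs ([contractible_good]).  They are disjoint, and
there is one for each repeated letter, so that the element is content maximal
([good_content_maximal]).  Conversely, let w be freely braided.  In every
reduced word of w, a contractible triple still sits on three letters i, j, i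
with no other neighbour of i in between ([split_triple_exists]).  Deleting the
last letter of each triple leaves a word of length l(w) - N(w) with the same
support, so that in the content maximal case its letters are distinct; two
equal letters of the original word must then belong to one triple
([same_letter_contractible]), and the word is good ([content_maximal_good]).

Finally [enum_good] lists good words vertex by vertex.  A new leaf v attached
to p is left out, put in front, put behind (if p occurs), or put around (if p
occurs and is unmatched).  Up to braid equivalence this meets every good word
([enum_good_complete]) exactly once ([enum_good_inj]), and along a path the
sizes of the lists satisfy f(n+3) + f(n) = 3 f(n+2) + f(n+1)
([size_enum_good_rec]). *)

Set Implicit Arguments.
Unset Strict Implicit.
Unset Printing Implicit Defensive.

Import Order.TTheory GRing.Theory Num.Theory.
Local Open Scope classical_set_scope.
Local Open Scope ring_scope.

(** * Good words and their invariance under braid moves *)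

Section Words.
Local Open Scope nat_scope.
Variables (T : eqType) (e : rel T).
Hypotheses (e_sym : symmetric e) (e_irr : irreflexive e).
Implicit Types (i j k x y : T) (u a b : seq T).

(** The relation [e] is the adjacency of the Coxeter graph: nonadjacent letters
commute, adjacent ones satisfy the braid relation.  Cancellation of squares is
left out on purpose, so that moves preserve the length of words. *)
Inductive braid_move : seq T -> seq T -> Prop :=
| braid_move_comm a b i j : i != j -> ~~ e i j ->
    braid_move (a ++ [:: i; j] ++ b) (a ++ [:: j; i] ++ b)
| braid_move_braid a b i j : e i j ->
    braid_move (a ++ [:: i; j; i] ++ b) (a ++ [:: j; i; j] ++ b).

Inductive braid_eq u : seq T -> Prop :=
| braid_eq_refl : braid_eq u u
| braid_eq_step v w : braid_eq u v -> braid_move v w -> braid_eq u w.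

Lemma braid_move_braid_eq u v : braid_move u v -> braid_eq u v.
Proof. exact/braid_eq_step/braid_eq_refl. Qed.

Lemma braid_eq_trans v u w : braid_eq u v -> braid_eq v w -> braid_eq u w.
Proof. by move=> uv; elim=> // x y _ ux xy; apply: braid_eq_step xy. Qed.

Lemma braid_move_sym u v : braid_move u v -> braid_move v u.
Proof.
case=> [a b i j ij eij|a b i j eij]; last by apply: braid_move_braid; rewrite e_sym.
by apply: braid_move_comm; rewrite 1?eq_sym 1?e_sym.
Qed.

Lemma braid_eq_sym u v : braid_eq u v -> braid_eq v u.
Proof.
elim=> [|x y _ IH /braid_move_sym /braid_move_braid_eq yx]; first exact: braid_eq_refl.
exact: braid_eq_trans yx IH.
Qed.

Lemma braid_eq_ctx a b u v : braid_eq u v -> braid_eq (a ++ u ++ b) (a ++ v ++ b).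
Proof.
elim=> [|x y _ IH xy]; first exact: braid_eq_refl.
apply: (braid_eq_step IH); case: xy => [c d i j ij eij|c d i j eij].
  by have := braid_move_comm (a ++ c) (d ++ b) ij eij; rewrite -!catA.
by have := braid_move_braid (a ++ c) (d ++ b) eij; rewrite -!catA.
Qed.

Lemma braid_eq_catl a u v : braid_eq u v -> braid_eq (a ++ u) (a ++ v).
Proof. by move=> /(braid_eq_ctx a [::]); rewrite !cats0. Qed.

Lemma braid_eq_catr b u v : braid_eq u v -> braid_eq (u ++ b) (v ++ b).
Proof. exact: (@braid_eq_ctx [::] b). Qed.

(** The letter [i] must not occur in [u] itself, so that moving it through
[u] is a sequence of commutation moves. *)
Definition commutes i u := all (fun j => (i != j) && ~~ e i j) u.

Lemma braid_eq_bubble i u : commutes i u -> braid_eq (i :: u) (u ++ [:: i]).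
Proof.
elim: u => [_|j u IH /= /andP[/andP[ij eij] cu]]; first exact: braid_eq_refl.
apply: braid_eq_trans (braid_eq_catl [:: j] (IH cu)).
exact: braid_move_braid_eq (braid_move_comm [::] u ij eij).
Qed.

Lemma braid_eq_mem u v : braid_eq u v -> u =i v.
Proof.
elim=> // x y _ IH xy i; rewrite IH.
by case: xy => a b k l *; rewrite !mem_cat !inE; case: (i == k); case: (i == l);
  case: (i \in a).
Qed.

(** Interlacing of two adjacent letters; in a good word only the two letters of a
long braid interlace. *)
Definition matched u i j :=
  e i j && (subseq [:: i; j; i] u || subseq [:: j; i; j] u).

(** The words that commutations turn into a concatenation of single letters
and long braids with pairwise disjoint supports.  The matching is not part of
the data: it can be read off the word. *)
Definition good u :=
  [/\ forall i j k, matched u i j -> matched u i k -> j = k,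
      forall i j, matched u i j -> count_mem i u + count_mem j u = 3 &
      forall i, (forall j, ~~ matched u i j) -> count_mem i u <= 1].

Lemma matchedC u i j : matched u i j = matched u j i.
Proof. by rewrite /matched e_sym orbC. Qed.

Lemma adj_neq i j : e i j -> i != j.
Proof. by apply: contraTneq => ->; rewrite e_irr. Qed.

Lemma subseq_cons_split i s u :
  subseq (i :: s) u -> exists a u', [/\ u = a ++ i :: u', i \notin a & subseq s u'].
Proof.
elim: u => // x u IH /=; have [->|xi] := eqVneq x i; first by exists [::], u.
by case/IH=> a [u' [-> ia su]]; exists (x :: a), u'; rewrite inE eq_sym negb_or xi.
Qed.

Lemma subseq3_split i j k u : subseq [:: i; j; k] u ->
  exists a b c d, u = a ++ i :: b ++ j :: c ++ k :: d.
Proof.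
case/subseq_cons_split=> a [? [-> _ /subseq_cons_split[b [? [-> _ ]]]]].
by case/subseq_cons_split=> c [d [-> _ _]]; exists a, b, c, d.
Qed.

Lemma subseq3_cat i j k a b c d :
  subseq [:: i; j; k] (a ++ i :: b ++ j :: c ++ k :: d).
Proof.
have stp : forall x s u u', subseq s u' -> subseq (x :: s) (u ++ x :: u').
  move=> x s u u' su; rewrite -[x :: s]cat0s; apply: cat_subseq; first exact: sub0seq.
  by rewrite /= eqxx.
by do 3!apply/stp; apply: sub0seq.
Qed.

Lemma subseq_aba_count i j u : i != j -> subseq [:: i; j; i] u ->
  1 < count_mem i u /\ 0 < count_mem j u.
Proof.
move=> ij su; have := leq_count_subseq (pred1 i) su.
have := leq_count_subseq (pred1 j) su.
by rewrite /= !eqxx (negPf ij) eq_sym (negPf ij).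
Qed.

Lemma subseq_filter_pair i j s u : all (pred2 i j) s ->
  subseq s u = subseq s (seq.filter (pred2 i j) u).
Proof. by move=> alls; rewrite subseq_filter alls. Qed.

Lemma matched_eq_filter u v i j :
  seq.filter (pred2 i j) u = seq.filter (pred2 i j) v -> matched u i j = matched v i j.
Proof.
move=> uv; have eq_sub s : all (pred2 i j) s -> subseq s u = subseq s v.
  by move=> alls; rewrite (subseq_filter_pair u alls) uv -subseq_filter_pair.
by rewrite /matched !eq_sub //= !eqxx ?orbT.
Qed.

Lemma good_matched_aba u i j : good u -> e i j -> subseq [:: i; j; i] u ->
  count_mem i u = 2 /\ count_mem j u = 1.
Proof.
move=> [_ cnt _] eij su; have [] := subseq_aba_count (adj_neq eij) su.
by have := cnt i j; rewrite /matched eij su => /(_ isT); lia.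
Qed.

(** A neighbour of [i] between the two occurrences of [i] would be matched with
[i], hence equal to [j]; this is what allows a long braid to be gathered. *)
Lemma good_aba_commutes u a b c d i j : good u -> e i j ->
  u = a ++ i :: b ++ j :: c ++ i :: d -> commutes i b /\ commutes i c.
Proof.
move=> gu eij uE; have su : subseq [:: i; j; i] u by rewrite uE subseq3_cat.
have [ci cj] := good_matched_aba gu eij su.
have Mij : matched u i j by rewrite /matched eij su.
have := ci; have := cj; rewrite uE !count_cat /= !count_cat /= !count_cat /= !eqxx.
have ij := negPf (adj_neq eij); have ji : (j == i) = false by rewrite eq_sym.
rewrite ?ij ?ji => cj' ci'.
have outi x : x \in b ++ c -> i != x.
  by apply: contraTneq => <-; rewrite mem_cat -!has_pred1 !has_count; lia.
have outj x : x \in b ++ c -> j != x.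
  by apply: contraTneq => <-; rewrite mem_cat -!has_pred1 !has_count; lia.
have nadj x : x \in b ++ c -> subseq [:: i; x; i] u -> ~~ e i x.
  move=> xbc sx; apply: contraNN (outj _ xbc) => eix; apply/eqP.
  by case: gu => uniqM _ _; apply: (uniqM i) => //; rewrite /matched eix sx.
split; apply/allP=> x xin; have xbc : x \in b ++ c by rewrite mem_cat xin ?orbT.
  rewrite outi //=; apply: nadj => //; rewrite uE; case/splitPr: xin => b1 b2.
  by have := subseq3_cat i x i a b1 (b2 ++ j :: c) d; rewrite -?catA /= -?catA.
rewrite outi //=; apply: nadj => //; rewrite uE; case/splitPr: xin => c1 c2.
by have := subseq3_cat i x i a (b ++ j :: c1) c2 d; rewrite -?catA /= -?catA.
Qed.

Lemma braid_eq_gather a b c d i j : commutes i b -> commutes i c ->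
  braid_eq (a ++ i :: b ++ j :: c ++ i :: d) ((a ++ b) ++ [:: i; j; i] ++ c ++ d).
Proof.
move=> cb cc.
apply: (@braid_eq_trans ((a ++ b) ++ i :: j :: c ++ i :: d)).
  have := braid_eq_ctx a (j :: c ++ i :: d) (braid_eq_bubble cb).
  by rewrite -!catA /=.
have := braid_eq_ctx ((a ++ b) ++ [:: i; j]) d (braid_eq_sym (braid_eq_bubble cc)).
by rewrite -!catA /=.
Qed.

Lemma filter_pair_comm i j x y a b : e i j -> x != y -> ~~ e x y ->
  seq.filter (pred2 i j) (a ++ [:: x; y] ++ b) = seq.filter (pred2 i j) (a ++ [:: y; x] ++ b).
Proof.
move=> eij xy exy; rewrite !filter_cat; congr (_ ++ (_ ++ _)) => /=.
case: ifP => xij; case: ifP => yij //; case/orP: xij xy exy => /eqP->;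
  case/orP: yij => /eqP->; by rewrite ?eqxx ?(e_sym j i) ?eij.
Qed.

Lemma subseq_cons_notin i s a u : i \notin a ->
  subseq (i :: s) (a ++ u) = subseq (i :: s) u.
Proof.
by elim: a => //= x a IH; rewrite inE negb_or eq_sym => /andP[/negPf-> /IH].
Qed.

Lemma subseq_pair_cat x j (c b : seq T) : x \in c -> j \notin c ->
  subseq [:: x; j] (c ++ b) = (j \in b).
Proof.
elim: c => // y c IH; rewrite !inE negb_or eq_sym /= => xyc /andP[jy jc].
case: eqVneq xyc => [_ _|_ /IH->//].
by rewrite sub1seq mem_cat (negPf jc).
Qed.

(** This compares two stretches [c] that contain [x] a different number of
times, and is why a long braid can change its orientation without affecting
the other pairs. *)
Lemma subseq_sep j x (a c b : seq T) : x \notin a -> x \notin b -> j \notin c -> x \in c ->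
  subseq [:: j; x; j] (a ++ c ++ b) = (j \in a) && (j \in b).
Proof.
move=> xa xb jc xc; elim: a xa => [_|y a IH].
  rewrite cat0s subseq_cons_notin //=; apply/negP.
  case/subseq_cons_split=> ? [b' [bE _]]; rewrite -[[:: x; j]]cat1s.
  move=> /(subseq_trans (prefix_subseq _ _)); rewrite sub1seq => xb'.
  by rewrite bE mem_cat inE xb' !orbT in xb.
rewrite inE negb_or => /andP[xy xa] /=; rewrite inE eq_sym.
case: (eqVneq j y) => [yj|_ /=]; last exact: IH.
by rewrite subseq_cons_notin //=; apply: subseq_pair_cat.
Qed.

Lemma subseq_nosep i j a c b : i \notin a -> i \notin b -> j \notin c ->
  subseq [:: i; j; i] (a ++ c ++ b) = false.
Proof.
move=> ia ib jc; rewrite subseq_cons_notin //; apply/negP.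
have noi s : subseq (rcons s i) b -> False.
  by move=> /mem_subseq/(_ i); rewrite mem_rcons inE eqxx (negPf ib) => /(_ isT).
elim: c jc => [_ /(noi [:: i; j])//|z c IH]; rewrite inE negb_or /= => /andP[_ jc].
case: eqP => _; last exact: IH.
by rewrite subseq_cons_notin // => /(noi [:: j]).
Qed.

(** By [subseq_sep] and [subseq_nosep]; it is applied with the two sides of a
braid relation for [c] and [c']. *)
Lemma matched_replace i j a c c' b : c =i c' -> i \in c -> i \notin a -> i \notin b ->
  j \notin c -> matched (a ++ c ++ b) i j = matched (a ++ c' ++ b) i j.
Proof.
move=> cc' ic ia ib jc; have ic' : i \in c' by rewrite -cc'.
have jc' : j \notin c' by rewrite -cc'.
by rewrite /matched !(@subseq_nosep i j) // !(@subseq_sep j i).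
Qed.

Lemma good_braid_notin a b i j : e i j -> good (a ++ [:: i; j; i] ++ b) ->
  [/\ i \notin a, i \notin b, j \notin a & j \notin b].
Proof.
move=> eij gu; have ij := negPf (adj_neq eij).
have ji : (j == i) = false by rewrite eq_sym.
have su := @subseq3_cat i j i a [::] [::] b.
have [] := good_matched_aba gu eij su.
rewrite !count_cat /= !eqxx ij ji -!has_pred1 !has_count => c1 c2; split; lia.
Qed.

(** A commutation does not change the relative order of adjacent letters, and a
braid move changes only the two letters that it involves. *)
Lemma matched_step u v i j : good u -> braid_move u v -> matched v i j = matched u i j.
Proof.
move=> gu uv; have [eij|neij] := boolP (e i j); last by rewrite /matched (negPf neij).
case: uv gu => [a b x y xy exy _|a b x y exy gu].
  by apply: matched_eq_filter; rewrite -filter_pair_comm.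
have [xa xb ya yb] := good_braid_notin exy gu.
have cc' : [:: y; x; y] =i [:: x; y; x].
  by move=> z; rewrite !inE; case: (z == x); case: (z == y).
have eyx : e y x by rewrite e_sym.
have Mxy a' b' x' y' : e x' y' -> matched (a' ++ [:: x'; y'; x'] ++ b') x' y'.
  by move=> exy'; rewrite /matched exy' (@subseq3_cat x' y' x' a' [::] [::] b').
have one k l : k \in [:: x; y; x] -> l \notin [:: x; y; x] ->
    matched (a ++ [:: y; x; y] ++ b) k l = matched (a ++ [:: x; y; x] ++ b) k l.
  move=> kin lout; apply: matched_replace; rewrite ?cc' //.
    by move: kin; rewrite !inE => /or3P[]/eqP->.
  by move: kin; rewrite !inE => /or3P[]/eqP->.
have two k l : e k l -> k \in [:: x; y; x] -> l \in [:: x; y; x] ->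
    matched (a ++ [:: y; x; y] ++ b) k l = matched (a ++ [:: x; y; x] ++ b) k l.
  rewrite !inE => ekl kin lin; have : k = x /\ l = y \/ k = y /\ l = x.
    by case/or3P: kin ekl => /eqP->; case/or3P: lin => /eqP->; rewrite ?e_irr //; auto.
  case.
  - by case=> -> ->; rewrite Mxy // matchedC Mxy.
  by case=> -> ->; rewrite Mxy // matchedC Mxy.
have [iin|iout] := boolP (i \in [:: x; y; x]); have [jin|jout] := boolP (j \in [:: x; y; x]).
- exact: two.
- exact: one.
- by rewrite matchedC [RHS]matchedC one.
have fE c : all (mem [:: x; y;
  x]) c -> seq.filter (pred2 i j) (a ++ c ++ b) = seq.filter (pred2 i j) (a ++ b).
  move=> /allP allc; rewrite !filter_cat; congr (_ ++ _).
  rewrite -[RHS]cat0s; congr (_ ++ _); apply/eqP; rewrite -[_ == _]negbK -has_filter.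
  apply/hasPn => z /allc zin /=; apply: contraTN zin => /orP[]/eqP-> //.
by apply: matched_eq_filter; rewrite !(fE [:: _; _; _]) //= !inE !eqxx !orbT.
Qed.

(** In a good word a braid move can only apply to a matched pair, whose two
letters it exchanges: the counts 2 and 1 become 1 and 2. *)
Lemma good_step u v : good u -> braid_move u v -> good v.
Proof.
move=> gu uv; have M i j := matched_step i j gu uv; have [uniqM cntM cnt1] := gu.
split=> [i j k|i j|i].
- by rewrite !M; apply: uniqM.
- rewrite M; case: uv gu M uniqM cntM cnt1 => [a b x y _ _ _ _ _ cntM _|].
    by move=> /cntM; rewrite !count_cat /=; lia.
  move=> a b x y exy gu M uniqM cntM _ Mij.
  have Mxy : matched (a ++ [:: x; y; x] ++ b) x y.
    by rewrite /matched exy (@subseq3_cat x y x a [::] [::] b).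
  have := cntM _ _ Mij; have := cntM _ _ Mxy; rewrite !count_cat /= !eqxx.
  have xy := negPf (adj_neq exy); have yx : (y == x) = false by rewrite eq_sym.
  have [ix|ix] := eqVneq x i.
    have jy : j = y by apply: (uniqM i) => //; rewrite -ix.
    by rewrite -ix jy !eqxx ?xy ?yx; lia.
  have [iy|iy] := eqVneq y i.
    have jx : j = x by apply: (uniqM i) => //; rewrite -iy matchedC.
    by rewrite -iy jx !eqxx ?xy ?yx; lia.
  have jx : (x == j) = false.
    apply/negbTE/eqP=> xj; case/eqP: iy; apply: (uniqM x) => //.
    by move: Mij; rewrite matchedC -xj.
  have jy : (y == j) = false.
    apply/negbTE/eqP=> yj; case/eqP: ix; apply: (uniqM y); first by rewrite matchedC.
    by move: Mij; rewrite matchedC -yj.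
  by rewrite jx jy; clear; lia.
move=> Mi; have := cnt1 i (fun j => etrans (congr1 negb (esym (M i j))) (Mi j)).
case: uv gu M Mi => [a b x y _ _ _ _ _|a b x y exy gu M Mi].
  by rewrite !count_cat /=; lia.
rewrite !count_cat /=; have [ix|_] := eqVneq x i; first lia.
have [iy|_] := eqVneq y i; last by lia.
by have /negP[] := Mi x; rewrite M -iy matchedC /matched exy (@subseq3_cat x y x a [::] [::] b).
Qed.

Lemma good_braid_eq u v : good u -> braid_eq u v -> good v /\ matched v =2 matched u.
Proof.
move=> gu; elim=> [|x y _ [gx Mx] xy]; first by split.
by split=> [|i j]; [exact: good_step xy|rewrite (matched_step _ _ gx xy)].
Qed.


Lemma matched_mem u i j : matched u i j -> j \in u.
Proof. by case/andP=> _ /orP[] /mem_subseq/(_ j); rewrite !inE eqxx ?orbT; apply. Qed.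

Lemma good_matched_or u i : good u ->
  (exists j, matched u i j) \/ count_mem i u <= 1 /\ forall j, ~~ matched u i j.
Proof.
move=> [_ _ cnt1]; have [/hasP[j _ Mij]|/hasPn nM] := boolP (has (matched u i) u).
  by left; exists j.
have {}nM j : ~~ matched u i j by apply/negP=> Mij; have /negP := nM j (matched_mem Mij).
by right; split=> //; apply: cnt1.
Qed.

Lemma matched_count u i j : good u -> matched u i j ->
  count_mem i u = 2 /\ count_mem j u = 1 \/ count_mem i u = 1 /\ count_mem j u = 2.
Proof.
move=> gu /[dup] Mij /andP[eij /orP[]] su; first by left; apply: good_matched_aba su.
by right; have [] : count_mem j u = 2 /\ count_mem i u = 1 by apply: good_matched_aba;
  rewrite 1?e_sym.
Qed.

Lemma matched_aba u i j : good u -> matched u i j -> count_mem i u = 2 ->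
  subseq [:: i; j; i] u.
Proof.
move=> gu /andP[eij /orP[//|su]] ci.
by have [_] : count_mem j u = 2 /\ count_mem i u = 1 by [apply: good_matched_aba su;
  rewrite 1?e_sym]; rewrite ci.
Qed.

Lemma good_count_le2 u i : good u -> count_mem i u <= 2.
Proof.
move=> gu; case: (good_matched_or i gu) => [[j Mij]|[]]; last by lia.
by case: (matched_count gu Mij) => -[-> _].
Qed.

(** A letter that occurs twice has its partner in between. *)
Lemma good_no_square a i b : ~ good (a ++ [:: i; i] ++ b).
Proof.
move=> gu; have c2 : count_mem i (a ++ [:: i; i] ++ b) >= 2.
  by rewrite !count_cat /= eqxx; lia.
case: (good_matched_or i gu) => [[j Mij]|[]]; last by lia.
case: (matched_count gu Mij) => [[ci cj]|]; last by lia.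
have ci' := ci; rewrite !count_cat /= eqxx in ci'.
have := matched_aba gu Mij ci; rewrite subseq_nosep //; try by apply/count_memPn; lia.
by have [eij _] := andP Mij; rewrite !inE orbb eq_sym adj_neq.
Qed.

(** * Good words built by adding a leaf *)

Lemma matched_rev u i j : matched (rev u) i j = matched u i j.
Proof.
have E s : rev s = s -> subseq s (rev u) = subseq s u.
  by move=> sE; rewrite -{1}sE subseq_rev.
by rewrite /matched !E.
Qed.

Lemma good_rev u : good u -> good (rev u).
Proof.
case=> uniqM cntM cnt1; split=> [i j k|i j|i].
- by rewrite !matched_rev; apply: uniqM.
- by rewrite matched_rev !count_rev; apply: cntM.
by rewrite count_rev => Mi; apply: cnt1 => j; rewrite -matched_rev.
Qed.

Lemma matched_filter v u i j :
  matched (seq.filter (predC1 v) u) i j = [&& i != v, j != v & matched u i j].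
Proof.
rewrite /matched !subseq_filter /=.
by case: (i == v); case: (j == v); rewrite /= ?andbF ?andbT.
Qed.

Lemma filter_predC1_id v u : v \notin u -> seq.filter (predC1 v) u = u.
Proof.
by move=> vu; apply/all_filterP/allP => x xu; apply: contraNneq vu => <-.
Qed.

Lemma count_filter_predC1 v i u :
  count_mem i (seq.filter (predC1 v) u) = if i == v then 0 else count_mem i u.
Proof.
rewrite count_filter; have [->|iv] := eqVneq i v.
  by rewrite -(count_pred0 u); apply: eq_count => x /=; case: eqP.
by apply: eq_count => x /=; case: eqVneq => // ->.
Qed.

(** Erasing [v] unmatches its partner, which must therefore occur only once. *)
Lemma good_filter v u : good u ->
  (forall p, matched u v p -> count_mem p u <= 1) -> good (seq.filter (predC1 v) u).
Proof.
move=> [uniqM cntM cnt1] vp; split=> [i j k|i j|i].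
- by rewrite !matched_filter => /and3P[_ _ Mij] /and3P[_ _]; apply: uniqM Mij.
- rewrite matched_filter !count_filter_predC1 => /and3P[/negPf-> /negPf->].
  exact: cntM.
rewrite count_filter_predC1; case: eqVneq => // iv Mi.
have [Mvi|nMvi] := boolP (matched u v i); first exact: vp.
apply: cnt1 => j; have [->|jv] := eqVneq j v; first by rewrite matchedC.
by have := Mi j; rewrite matched_filter iv jv.
Qed.

Lemma matched_cons v u : v \notin u -> matched (v :: u) =2 matched u.
Proof.
move=> vu i j; have no k l : subseq [:: k; l; k] (v :: u) = subseq [:: k; l; k] u.
  rewrite [LHS]/=; have [->|//] := eqVneq k v.
  have noS s : subseq (rcons s v) u = false.
    by apply/negP=> /mem_subseq/(_ v); rewrite mem_rcons inE eqxx (negPf vu) => /(_ isT).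
  by rewrite (noS [:: l]) (noS [:: v; l]).
by rewrite /matched !no.
Qed.

Lemma good_cons v u : v \notin u -> good u -> good (v :: u).
Proof.
move=> vu [uniqM cntM cnt1]; have M := matched_cons vu.
have nomem i : i \notin u -> count_mem i u = 0 by move/count_memPn.
have inM i j : matched u i j -> i \in u.
  by case/andP=> _ /orP[] /mem_subseq/(_ i); rewrite !inE eqxx ?orbT; apply.
split=> [i j k|i j|i].
- by rewrite !M; apply: uniqM.
- rewrite M => Mij /=; have iu := inM _ _ Mij.
  have ju : j \in u by apply: (inM j i); rewrite matchedC.
  have /negPf-> : v != i by apply: contraNneq vu => ->.
  have /negPf-> : v != j by apply: contraNneq vu => ->.
  exact: cntM.
move=> Mi /=; have [<-|_] := eqVneq v i; first by rewrite nomem.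
by apply: cnt1 => j; rewrite -M.
Qed.

Lemma matched_rcons v u : v \notin u -> matched (rcons u v) =2 matched u.
Proof.
by move=> vu i j; rewrite -matched_rev rev_rcons matched_cons ?mem_rev // matched_rev.
Qed.

Lemma good_rcons v u : v \notin u -> good u -> good (rcons u v).
Proof.
move=> vu gu; rewrite -[rcons _ _]revK rev_rcons.
by apply/good_rev/good_cons/good_rev; rewrite ?mem_rev.
Qed.

Lemma filter_around v u : v \notin u -> seq.filter (predC1 v) (v :: rcons u v) = u.
Proof.
by move=> vu; rewrite /= eqxx /= filter_rcons /= eqxx /= filter_predC1_id.
Qed.

(** For a leaf [v], the only letter that two occurrences of [v] can enclose
and be matched with is its neighbour [p]. *)
Lemma matched_around v p u : v \notin u -> p \in u ->
  {in u, forall x, e v x = (x == p)} ->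
  matched (v :: rcons u v) v =1 pred1 p.
Proof.
move=> vu pu vleaf j; rewrite /matched /= eqxx.
have -> : subseq [:: j; v] (rcons u v) = (j \in u).
  apply/idP/idP=> [|ju].
    rewrite -subseq_rev rev_rcons /= eqxx sub1seq mem_rev //.
  rewrite -cats1 -[[:: j; v]]/([:: j] ++ [:: v]).
  by apply: cat_subseq; rewrite sub1seq ?mem_seq1.
have [ju|ju] := boolP (j \in u); first by rewrite vleaf ?andbT.
have -> : (j == p) = false by apply: contraNF ju => /eqP->.
have [jv|jv] := eqVneq j v; first by rewrite jv e_irr.
rewrite /=; apply/negP=> /andP[_ /mem_subseq/(_ j)].
by rewrite !inE eqxx /= mem_rcons inE (negPf jv) (negPf ju) => /(_ isT).
Qed.

(** This creates the new matched pair formed by the leaf [v] and its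
neighbour [p], in the orientation vpv.  No other pair is affected, as [p] was
unmatched. *)
Lemma good_around v p u : v \notin u -> p \in u ->
  {in u, forall x, e v x = (x == p)} -> (forall j, ~~ matched u p j) ->
  good u -> good (v :: rcons u v).
Proof.
move=> vu pu vleaf pfree [uniqM cntM cnt1]; have Mv := matched_around vu pu vleaf.
have pv : p != v by apply: contraNneq vu => <-.
have cp : count_mem p u = 1.
  by apply/eqP; rewrite eqn_leq cnt1 //= -has_count has_pred1.
have M i j : i != v -> j != v -> matched (v :: rcons u v) i j = matched u i j.
  by move=> iv jv; rewrite -[in RHS](filter_around vu) matched_filter iv jv.
have cv : count_mem v u = 0 by apply/count_memPn.
have cE i : count_mem i (v :: rcons u v) = if v == i then 2 else count_mem i u.
  rewrite /= -cats1 count_cat /=; case: eqVneq => [<-|]; lia.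
have Mp j : matched (v :: rcons u v) p j -> j = v.
  have [//|jv] := eqVneq j v.
  by rewrite M // (negPf (pfree j)).
split=> [i j k|i j|i].
- have [->|iv] := eqVneq i v; first by rewrite !Mv => /eqP-> /eqP->.
  have [->|ip] := eqVneq i p; first by move=> /Mp-> /Mp->.
  have jv l : matched (v :: rcons u v) i l -> l != v.
    by apply: contraTneq => ->; rewrite matchedC Mv.
  move=> Mij Mik; move: (Mij) (Mik); rewrite !M ?(jv j) ?(jv k) //; exact: uniqM.
- rewrite !cE; have [<-|iv] := eqVneq v i.
    by rewrite Mv => /eqP->; rewrite eq_sym (negPf pv) cp.
  have [<-|jv] := eqVneq v j.
    by rewrite matchedC Mv => /eqP->; rewrite cp.
  by rewrite M 1?eq_sym //; apply: cntM.
rewrite cE; case: eqVneq => [<- /(_ p)|vi Mi]; first by rewrite Mv /= eqxx.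
apply: cnt1 => j; have [->|jv] := eqVneq j v; last by rewrite -M // eq_sym.
by apply/negP=> /andP[_ /orP[]] /mem_subseq/(_ v); rewrite !inE eqxx ?orbT (negPf vu) => /(_ isT).
Qed.

Definition flank v (c : bool * bool) u : seq T :=
  (if c.1 then [:: v] else [::]) ++ u ++ (if c.2 then [:: v] else [::]).

(** An entry is a good word with the list of its matched letters.  If the
neighbour [op] of the new leaf does not occur, the leaf commutes with the whole
word and only one position is listed for it. *)
Definition choices (op : option T) (z : seq T * seq T) : seq (bool * bool) :=
  [:: (false, false); (true, false)] ++
  if op is Some p then
    if p \in z.1 then
      (false, true) :: if p \in z.2 then [::] else [:: (true, true)]
    else [::]
  else [::].

Definition mark v (op : option T) (c : bool * bool) (ms : seq T) :=
  if op is Some p then if c.1 && c.2 then [:: v, p & ms] else ms else ms.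

(** One good word in each braid class, for the graph built by adding the
vertices of [vs] from right to left.  Each vertex comes with the earlier vertex
to which it is attached, if there is one. *)
Fixpoint enum_good (vs : seq (T * option T)) : seq (seq T * seq T) :=
  if vs is (v, op) :: vs' then
    [seq (flank v c z.1, mark v op c z.2) | z <- enum_good vs', c <- choices op z]
  else [:: ([::], [::])].

(** Each vertex has at most one neighbour among those added before it, so
the graph is a forest. *)
Fixpoint leaf_order (vs : seq (T * option T)) : bool :=
  if vs is (v, op) :: vs' then
    [&& v \notin unzip1 vs', all (fun x => e v x == (op == Some x)) (unzip1 vs')
      & leaf_order vs']
  else true.

Definition wf_entry (vs : seq (T * option T)) (z : seq T * seq T) :=
  [/\ good z.1, {subset z.1 <= unzip1 vs} &
      forall i, i \in z.2 <-> exists j, matched z.1 i j].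

Lemma choicesP op z c : c \in choices op z ->
  c = (false, false) \/ c = (true, false) \/
  exists p, [/\ op = Some p, p \in z.1 &
     c = (false, true) \/ (c = (true, true) /\ p \notin z.2)].
Proof.
rewrite /choices mem_cat !inE => /orP[/orP[]/eqP->|]; auto.
case: op => // p; case: ifP => // px; rewrite inE => /orP[/eqP->|].
  by right; right; exists p; split=> //; left.
case: ifP => // pm; rewrite inE => /eqP->.
by right; right; exists p; split=> //; right; rewrite pm.
Qed.

Lemma enum_goodP v op vs z : reflect
  (exists z' c, [/\ z' \in enum_good vs, c \in choices op z' &
    z = (flank v c z'.1, mark v op c z'.2)]) (z \in enum_good ((v, op) :: vs)).
Proof. exact: allpairsPdep. Qed.

(** Besides goodness this records that the second component of an entry is the
set of matched letters, on which [choices] relies. *)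
Lemma enum_good_wf vs z : leaf_order vs -> z \in enum_good vs -> wf_entry vs z.
Proof.
elim: vs z => [|[v op] vs IH] z.
  rewrite inE => _ /eqP->; split=> //=.
    by split=> [i j k|i j|i] //; rewrite /matched /= andbF.
  by move=> i; split=> // -[j]; rewrite /matched /= andbF.
move=> /and3P[vvs /allP vleaf lvs] /enum_goodP[y [c [yin cin ->]]].
have [gy sy my] := IH y lvs yin; have vy : v \notin y.1 by apply: contra vvs => /sy.
have fin u : u =i v :: y.1 -> {subset u <= v :: unzip1 vs}.
  by move=> uE q; rewrite uE !inE => /orP[->//|/sy->]; rewrite orbT.
case: (choicesP cin) => [->|[->|[p [opE py [->|[-> pm]]]]]]; split; rewrite /flank ?opE /mark /=.
- by rewrite cats0.
- by rewrite cats0 => q /sy; rewrite inE orbC => ->.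
- by rewrite cats0; case: op {vleaf cin}.
- by rewrite cats0; apply: good_cons.
- by rewrite cats0; apply: fin.
- move=> i; rewrite cats0; case: op {vleaf cin} => [p|]; rewrite my;
  by split=> -[j Mj]; exists j; move: Mj; rewrite matched_cons.
- by rewrite cats1; apply: good_rcons.
- by rewrite cats1; apply: fin => q; rewrite mem_rcons.
- by move=> i; rewrite my cats1; split=> -[j Mj]; exists j; move: Mj; rewrite matched_rcons.
- rewrite cats1; apply: (@good_around _ p) => //.
    by move=> q /sy/vleaf/eqP->; rewrite opE; apply/eqP/eqP => [[->]|->].
  by move=> j; apply: contra pm => Mj; apply/my; exists j.
- by rewrite cats1; apply: fin => q; rewrite inE mem_rcons inE orbA orbb.
move=> i; rewrite cats1.
have Mv := @matched_around v p y.1 vy py.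
have {}Mv : matched (v :: rcons y.1 v) v =1 pred1 p.
  by apply: Mv => q /sy/vleaf/eqP->; rewrite opE; apply/eqP/eqP => [[->]|->].
rewrite !inE; have [->|iv] := eqVneq i v; first by split=> // _; exists p; rewrite Mv /= eqxx.
have [->|ip] := eqVneq i p; first by split=> // _; exists v; rewrite matchedC Mv /= eqxx.
rewrite /= my; split=> -[j Mj]; exists j.
  have jv : j != v.
    apply: contraNneq vy => <-; case/andP: Mj => _ /orP[] /mem_subseq/(_ j);
    by rewrite !inE eqxx ?orbT; apply.
  by move: Mj; rewrite -[in X in X -> _](filter_around vy) matched_filter iv jv.
have jv : j != v by apply: contraTneq Mj => ->; rewrite matchedC Mv.
by rewrite -[in X in is_true X](filter_around vy) matched_filter iv jv.
Qed.

Lemma braid_eq_front v a b : commutes v a -> braid_eq (a ++ v :: b) (v :: a ++ b).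
Proof.
by move=> /braid_eq_bubble/(braid_eq_catr b)/braid_eq_sym; rewrite -catA.
Qed.

Lemma braid_eq_back v a b : commutes v b -> braid_eq (a ++ v :: b) (rcons (a ++ b) v).
Proof. by move=> /braid_eq_bubble/(braid_eq_catl a); rewrite catA cats1. Qed.

Section Complete.
Variables (v : T) (op : option T) (vs : seq (T * option T)).
Hypothesis leaf_v : leaf_order ((v, op) :: vs).
Hypothesis IH : forall u, good u -> {subset u <= unzip1 vs} ->
  exists2 y, y \in enum_good vs & braid_eq u y.1.

Lemma leaf_adj x : x \in unzip1 vs -> e v x = (op == Some x).
Proof. by move=> xvs; case/and3P: leaf_v => _ /allP/(_ _ xvs)/eqP. Qed.

Lemma leaf_commutes a : {subset a <= unzip1 vs} -> (if op is Some p then p \notin a else true) ->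
  commutes v a.
Proof.
move=> avs pa; apply/allP => x xa; have xvs := avs x xa.
have vvs : v \notin unzip1 vs by case/and3P: leaf_v.
rewrite (contraNneq _ vvs) => [|->//]; rewrite leaf_adj //=.
by case: op pa => // p; apply: contraNneq => -[->].
Qed.

Lemma enum_good_flank u w c z : braid_eq u (flank v c w) -> braid_eq w z.1 ->
  z \in enum_good vs -> c \in choices op z ->
  exists2 z', z' \in enum_good ((v, op) :: vs) & braid_eq u z'.1.
Proof.
move=> uw wz zin cin; exists (flank v c z.1, mark v op c z.2).
  by apply/enum_goodP; exists z, c.
by apply: braid_eq_trans uw _; apply: braid_eq_ctx.
Qed.

(** If the leaf [v] is the outer letter of a long braid vpv, its two occurrences
can be moved to the two ends of the word, because [p], the only neighbour of
[v], occurs only between them. *)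
Lemma complete_around u p : good u -> {subset u <= v :: unzip1 vs} -> e v p ->
  subseq [:: v; p; v] u -> exists2 z, z \in enum_good ((v, op) :: vs) & braid_eq u z.1.
Proof.
move=> gu uvs evp su; have [cv cp] := good_matched_aba gu evp su.
have [a [b [c [d uE]]]] := subseq3_split su.
have vp : (v == p) = false by apply/negbTE/eqP=> vp; rewrite vp e_irr in evp.
have pv : (p == v) = false by rewrite eq_sym.
have cp' := cp; have cv' := cv.
rewrite uE !count_cat /= !count_cat /= !count_cat /= !eqxx vp pv in cp' cv'.
have [va vb vc vd] : [/\ v \notin a, v \notin b, v \notin c & v \notin d].
  by move: cv'; rewrite -!has_pred1 !has_count; clear; split; lia.
have [pa pb pc pd] : [/\ p \notin a, p \notin b, p \notin c & p \notin d].
  by move: cp'; rewrite -!has_pred1 !has_count; clear; split; lia.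
pose w := a ++ b ++ p :: c ++ d.
have wE : seq.filter (predC1 v) u = w.
  rewrite uE filter_cat /= eqxx /= filter_cat /= pv /= filter_cat /= eqxx /=.
  by rewrite !filter_predC1_id.
have wvs : {subset w <= unzip1 vs}.
  by move=> x; rewrite -wE mem_filter => /andP[/= xv /uvs]; rewrite inE (negPf xv).
have pw : p \in w by rewrite !mem_cat inE eqxx !orbT.
have opp : op = Some p by apply/eqP; rewrite -leaf_adj // wvs.
have Mvp : matched u v p by rewrite /matched evp su.
have [uniqM cntM cnt1] := gu.
have gw : good w.
  by rewrite -wE; apply: good_filter => // q /(uniqM _ _ _ Mvp)<-; rewrite cp.
have com s : {subset s <= w} -> p \notin s -> commutes v s.
  by move=> sw ps; apply: leaf_commutes; [move=> x /sw/wvs|rewrite opp].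
have ca : commutes v a by apply: com => // x xa; rewrite mem_cat xa.
have cb : commutes v b by apply: com => // x xb; rewrite !mem_cat xb orbT.
have cc : commutes v c by apply: com => // x xc; rewrite !mem_cat inE mem_cat xc !orbT.
have cd : commutes v d by apply: com => // x xd; rewrite !mem_cat inE mem_cat xd !orbT.
have u_w : braid_eq u (flank v (true, true) w).
  rewrite uE /flank /w /=.
  apply: braid_eq_trans (braid_eq_front _ ca) _; apply: (braid_eq_catl [:: v]).
  have := @braid_eq_back v (a ++ b ++ p :: c) d cd.
  by rewrite -cats1 -!catA /= -!catA.
have [z zin wz] := IH gw wvs.
apply: (enum_good_flank u_w wz zin).
have [_ _ mz] := enum_good_wf (proj2 (andP (proj2 (andP leaf_v)))) zin.
rewrite /choices opp -(braid_eq_mem wz) pw mem_cat inE.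
case: ifP => [/mz[j]|_]; last by rewrite !inE eqxx !orbT.
have [_ ->] := good_braid_eq gw wz; rewrite -wE matched_filter => /and3P[_ jv Mpj].
by rewrite (uniqM p j v) ?eqxx // matchedC in jv.
Qed.

(** If the leaf [v] occurs once and is unmatched, its neighbour [p] does not
occur on both sides of it, so that [v] can be moved to one end. *)
Lemma complete_single u : good u -> {subset u <= v :: unzip1 vs} ->
  count_mem v u = 1 -> (forall p, ~~ matched u v p) ->
  exists2 z, z \in enum_good ((v, op) :: vs) & braid_eq u z.1.
Proof.
move=> gu uvs cv vfree.
have vu : v \in u by rewrite -has_pred1 has_count cv.
case/splitPr: vu cv gu uvs vfree => a b cv gu uvs vfree.
rewrite count_cat /= eqxx in cv.
have [va vb] : v \notin a /\ v \notin b.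
  by rewrite -!has_pred1 !has_count; split; lia.
have wE : seq.filter (predC1 v) (a ++ v :: b) = a ++ b.
  by rewrite filter_cat /= eqxx /= !filter_predC1_id.
have wvs : {subset a ++ b <= unzip1 vs}.
  by move=> x; rewrite -wE mem_filter => /andP[/= xv /uvs]; rewrite inE (negPf xv).
have gw : good (a ++ b).
  by rewrite -wE; apply: good_filter => // q; rewrite (negPf (vfree q)).
have [z zin wz] := IH gw wvs.
have front : commutes v a -> exists2 z, z \in enum_good ((v, op) :: vs) & braid_eq (a ++ v :: b) z.1.
  move=> ca; apply: (@enum_good_flank _ _ (true, false) _ _ wz zin).
    by rewrite /flank cats0; apply: braid_eq_front.
  by rewrite /choices mem_cat !inE.
have avs : {subset a <= unzip1 vs} by move=> x xa; apply: wvs; rewrite mem_cat xa.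
have bvs : {subset b <= unzip1 vs} by move=> x xb; apply: wvs; rewrite mem_cat xb orbT.
have [[p opp]|opN] : (exists p, op = Some p) \/ op = None.
  by case: (op) => [p|]; [left; exists p|right].
  have evp : p \in a ++ b -> e v p by move=> /wvs pvs; rewrite leaf_adj // opp.
  have [pa|pa] := boolP (p \in a); last by apply/front/leaf_commutes; rewrite // opp.
  have [pb|pb] := boolP (p \in b).
    have /negP[] := vfree p; rewrite /matched evp ?mem_cat ?pa //=.
    case/splitPr: pa => a1 a2; case/splitPr: pb => b1 b2; apply/orP; right.
    by rewrite -catA; apply: subseq3_cat.
  apply: (@enum_good_flank _ _ (false, true) _ _ wz zin).
    by rewrite /flank /= cats1; apply: braid_eq_back; apply: leaf_commutes; rewrite // opp.
  by rewrite /choices opp -(braid_eq_mem wz) mem_cat pa mem_cat !inE eqxx.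
by apply/front/leaf_commutes; rewrite // opN.
Qed.

End Complete.

(** By induction on the number of vertices: the last leaf is moved to the
ends of the word.  A braid pvp with [v] in the middle is first turned into
vpv. *)
Theorem enum_good_complete vs u : leaf_order vs -> good u -> {subset u <= unzip1 vs} ->
  exists2 z, z \in enum_good vs & braid_eq u z.1.
Proof.
elim: vs u => [|[v op] vs IHvs] u leaf_v gu uvs.
  exists ([::], [::]); first exact: mem_head.
  by case: u uvs {gu} => [|x u /(_ x)]; [left|rewrite mem_head => /(_ isT)].
have lvs : leaf_order vs by case/and3P: leaf_v.
have IH u' : good u' -> {subset u' <= unzip1 vs} ->
  exists2 z, z \in enum_good vs & braid_eq u' z.1 by apply: IHvs.
have [uniqM cntM cnt1] := gu.
have [vu|vu] := boolP (v \in u); last first.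
  have uvs' : {subset u <= unzip1 vs}.
    by move=> x xu; have := uvs x xu; rewrite inE => /orP[/eqP/= xv|//]; rewrite -xv xu in vu.
  have [z zin uz] := IH _ gu uvs'.
  apply: (@enum_good_flank _ _ _ _ u (false, false) _ _ uz zin).
    by rewrite /flank cats0; left.
  by rewrite /choices mem_cat !inE eqxx.
have cv : 0 < count_mem v u by rewrite -has_count has_pred1.
have [[p Mvp]|vfree] : (exists p, matched u v p) \/ forall p, ~~ matched u v p.
  have [/hasP[p pu Mvp]|/hasPn nM] := boolP (has (matched u v) u); first by left; exists p.
  right=> p; apply/negP=> Mvp; suff pu : p \in u by have /negP[] := nM p pu.
  by case/andP: Mvp => _ /orP[]/mem_subseq/(_ p); rewrite !inE eqxx ?orbT; apply.
  have [evp /orP[su|su]] := andP Mvp; first exact: (complete_around leaf_v IH gu uvs evp su).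
  have [a [b [c [d uE]]]] := subseq3_split su.
  have epv : e p v by rewrite e_sym.
  have [cb cc] := good_aba_commutes gu epv uE.
  have u_u' : braid_eq u ((a ++ b) ++ [:: v; p; v] ++ c ++ d).
    by rewrite uE; apply: braid_eq_step (braid_eq_gather _ _ _ cb cc) (braid_move_braid _ _ epv).
  have [gu' _] := good_braid_eq gu u_u'.
  have uvs' : {subset (a ++ b) ++ [:: v; p; v] ++ c ++ d <= v :: unzip1 vs}.
    by move=> x; rewrite -(braid_eq_mem u_u'); apply: uvs.
  have [z zin uz] := complete_around leaf_v IH gu' uvs' evp (@subseq3_cat v p v (a ++ b) [::] [::] _).
  by exists z => //; apply: braid_eq_trans uz.
apply: complete_single => //; apply/eqP; rewrite eqn_leq cv andbT.
exact: cnt1.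
Qed.

End Words.

(** * Each braid class of good words is listed once *)

Section Counting.
Local Open Scope nat_scope.
Variables (T : eqType) (e : rel T).
Hypotheses (e_sym : symmetric e) (e_irr : irreflexive e).
Implicit Types (i j k x : T) (u a b : seq T) (vs : seq (T * option T)).
Local Notation braid_move := (braid_move e).
Local Notation braid_eq := (braid_eq e).
Local Notation good := (good e).
Local Notation matched := (matched e).

(** Unmatched adjacent letters are never exchanged by a move, so which of them
comes first is an invariant of the braid class. *)
Lemma order_step u u' v p : good u -> braid_move u u' -> e v p -> ~~ matched u v p ->
  subseq [:: v; p] u' = subseq [:: v; p] u.
Proof.
move=> gu uu' evp; have eq_filter w w' : seq.filter (pred2 v p) w = seq.filter (pred2 v p) w' ->
    subseq [:: v; p] w = subseq [:: v; p] w'.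
  move=> ww'; have allvp : all (pred2 v p) [:: v; p] by rewrite /= !eqxx orbT.
  by rewrite (subseq_filter_pair w allvp) ww' -subseq_filter_pair.
case: uu' gu => [a b x y xy exy _ _|a b x y exy gu nM].
  by apply: eq_filter; rewrite -(filter_pair_comm e_sym).
have [xa xb ya yb] := good_braid_notin e_irr exy gu.
have Mxy : matched (a ++ [:: x; y; x] ++ b) x y.
  by rewrite /matched exy (@subseq3_cat _ x y x a [::] [::] b).
have first2 c w : w \in c -> w \notin a -> p \notin c -> v = w ->
  subseq [:: v; p] (a ++ c ++ b) = (p \in b).
  by move=> wc wa pc ->; rewrite subseq_cons_notin // subseq_pair_cat.
have last2 c w : w \in c -> w \notin b -> v \notin c -> p = w ->
  subseq [:: v; p] (a ++ c ++ b) = (v \in a).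
  move=> wc wb vc ->; rewrite -subseq_rev !rev_cat -catA subseq_cons_notin ?mem_rev //.
  by rewrite subseq_pair_cat ?mem_rev.
have inC z : (z \in [:: y; x; y]) = (z \in [:: x; y; x]).
  by rewrite !inE; case: (z == x); case: (z == y).
have nin z w : z \in [:: x; y; x] -> e z w -> ~~ matched (a ++ [:: x; y; x] ++ b) z w ->
    w \notin [:: x; y; x].
  move=> zin ezw; apply: contra => win; move: zin win ezw; rewrite !inE.
  by move=> /or3P[]/eqP-> /or3P[]/eqP->; rewrite ?e_irr // => _; rewrite 1?(matchedC e_sym) Mxy
     || rewrite (matchedC e_sym) Mxy.
have [vin|vout] := boolP (v \in [:: x; y; x]).
  have pout := nin _ _ vin evp nM; have va : v \notin a.
    by move: vin; rewrite !inE => /or3P[]/eqP->.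
  by rewrite !(@first2 _ v) ?inC.
have [pin|pout] := boolP (p \in [:: x; y; x]).
  have pb : p \notin b by move: pin; rewrite !inE => /or3P[]/eqP->.
  by rewrite !(@last2 _ p) ?inC.
apply: eq_filter; rewrite !filter_cat; congr (_ ++ (_ ++ _)).
have no c : all (mem [:: x; y; x]) c -> seq.filter (pred2 v p) c = [::].
  move=> /allP allc; apply/eqP; rewrite -[_ == _]negbK -has_filter.
  by apply/hasPn => z /allc zin /=; apply: contraTN zin => /orP[]/eqP->.
by rewrite !no //= !inE !eqxx ?orbT.
Qed.

Lemma order_braid_eq u u' v p : good u -> braid_eq u u' -> e v p -> ~~ matched u v p ->
  subseq [:: v; p] u' = subseq [:: v; p] u.
Proof.
move=> gu uu' evp nM; elim: uu' => // w w' uw IH ww'.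
have [gw Mw] := good_braid_eq e_sym e_irr gu uw.
by rewrite (order_step gw ww' evp) ?Mw.
Qed.

Section Distinct.
Variables (W : eqType) (phi : seq T -> W).
Hypothesis phi_braid_eq : forall u u', good u -> good u' -> phi u = phi u' -> braid_eq u u'.
Hypothesis phi_cancel : forall v c u u',
  phi (flank v c u) = phi (flank v c u') -> phi u = phi u'.

(** Three invariants of the braid class recover the position of the leaf [v]:
whether [v] occurs, whether it is matched with its neighbour, and whether it
precedes its neighbour.  In the application, [phi] maps a word to the group
element that it represents. *)
Lemma flank_inj v op vs z z' c c' : leaf_order e ((v, op) :: vs) ->
  z \in enum_good vs -> z' \in enum_good vs -> c \in choices op z -> c' \in choices op z' ->
  phi (flank v c z.1) = phi (flank v c' z'.1) -> c = c' /\ phi z.1 = phi z'.1.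
Proof.
move=> leaf_v zin z'in cz cz' phiE; suff cc' : c = c'.
  by split=> //; apply: (@phi_cancel v c); rewrite phiE cc'.
have [vvs /allP vleaf lvs] := and3P leaf_v.
have wfz := enum_good_wf e_sym e_irr lvs zin; have wfz' := enum_good_wf e_sym e_irr lvs z'in.
have zvs x : x \in z.1 -> x \in unzip1 vs by case: wfz => _ + _; apply.
have z'vs x : x \in z'.1 -> x \in unzip1 vs by case: wfz' => _ + _; apply.
have vz : v \notin z.1 by apply: contra vvs => /zvs.
have vz' : v \notin z'.1 by apply: contra vvs => /z'vs.
have wf_flank y d : y \in enum_good vs -> d \in choices op y -> good (flank v d y.1).
  move=> yin dy; have := @enum_good_wf _ _ e_sym e_irr ((v, op) :: vs) (flank v d y.1, mark v op d y.2) leaf_v.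
  by case=> //; apply/enum_goodP; exists y, d.
have gz := wf_flank _ _ zin cz; have gz' := wf_flank _ _ z'in cz'.
have br := phi_braid_eq gz gz' phiE.
have [_ Meq] := good_braid_eq e_sym e_irr gz br.
have vmem y d : v \notin y -> (v \in flank v d y) = d.1 || d.2.
  by move=> /negPf vy; rewrite /flank; case: d => -[] [];
    rewrite /= ?(inE, mem_cat, eqxx, vy) ?orbT.
have := braid_eq_mem br v; rewrite !vmem // => vcc'.
have pmem y d x : x != v -> (x \in flank v d y) = (x \in y).
  by move=> /negPf xv; rewrite /flank; case: d => -[] []; rewrite /= ?(inE, mem_cat, xv) ?orbF.
have nM y d x : v \notin y -> d.1 && d.2 = false -> matched (flank v d y) v x = false.
  have nMy : v \notin y -> matched y v x = false.
    move=> /negPf vy; apply/negP=> /andP[_ /orP[]] /mem_subseq/(_ v);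
    by rewrite !inE eqxx ?orbT vy => /(_ isT).
  move=> vy; rewrite /flank; case: d => -[] [] //= _; rewrite ?cats0.
  - by rewrite matched_cons // nMy.
  - by rewrite cats1 matched_rcons // nMy.
  exact: nMy.
have around y x : v \notin y -> e v x -> x \in y -> matched (flank v (true, true) y) v x.
  move=> vy evx xy; rewrite /matched evx /flank; case/splitPr: xy => y1 y2.
  by rewrite (_ : _ ++ _ = [::] ++ v :: y1 ++ x :: y2 ++ v :: [::]) ?subseq3_cat // /= -catA.
have front y x : x \in y -> subseq [:: v; x] (flank v (true, false) y).
  by move=> xy; rewrite /flank /= eqxx sub1seq cats0.
have back y x : v \notin y -> x != v -> subseq [:: v; x] (flank v (false, true) y) = false.
  by move=> vy xv; rewrite /flank /= subseq_cons_notin //= eqxx.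
case: (choicesP cz) (choicesP cz') => [cE|[cE|[p [opE pz cE]]]] [cE'|[cE'|[p' [opE' pz' cE']]]];
  move: vcc'; rewrite ?cE ?cE' //.
- by case: cE' => [|[]] ->.
- move=> _; have p'vs := z'vs _ pz'.
  have evp : e v p' by rewrite (eqP (vleaf _ p'vs)) opE' eqxx.
  have p'v : p' != v by apply: contraNneq vvs => <-.
  have pz : p' \in z.1 by rewrite -(pmem _ c) // (braid_eq_mem br) pmem.
  have nMc : ~~ matched (flank v c z.1) v p' by rewrite nM ?cE.
  case: cE' => [cE'|[cE' _]].
    by have := order_braid_eq gz br evp nMc; rewrite cE cE' front // back.
  by move: nMc; rewrite -Meq cE' around.
- by case: cE => [|[]] ->.
- move=> _; have pvs := zvs _ pz.
  have evp : e v p by rewrite (eqP (vleaf _ pvs)) opE eqxx.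
  have pv : p != v by apply: contraNneq vvs => <-.
  have pz' : p \in z'.1 by rewrite -(pmem _ c') // -(braid_eq_mem br) pmem.
  have nMc : ~~ matched (flank v c' z'.1) v p by rewrite nM ?cE'.
  have nMc2 : ~~ matched (flank v c z.1) v p by rewrite -Meq.
  case: cE => [cE|[cE _]].
    by have := order_braid_eq gz br evp nMc2; rewrite cE cE' front // back.
  by move: nMc2; rewrite cE around.
move=> _; have pvs := zvs _ pz; have evp : e v p by rewrite (eqP (vleaf _ pvs)) opE eqxx.
have pp' : p = p' by move: opE'; rewrite opE => -[].
rewrite -pp' in pz'.
case: cE cE' => [cE|[cE _]] [cE'|[cE' _]]; rewrite ?cE ?cE' //.
  by have := Meq v p; rewrite cE cE' around // nM.
by have := Meq v p; rewrite cE cE' around // nM.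
Qed.

Lemma enum_good_inj vs : leaf_order e vs ->
  uniq (enum_good vs) /\ {in enum_good vs &, injective (fun z => phi z.1)}.
Proof.
elim: vs => [_|[v op] vs IH leaf_v].
  by split=> // z z'; rewrite !inE => /eqP-> /eqP->.
have lvs : leaf_order e vs by case/and3P: leaf_v.
have [uvs ivs] := IH lvs; split; last first.
  move=> _ _ /enum_goodP[z [c [zin cz ->]]] /enum_goodP[z' [c' [zin' cz' ->]]] /= phiE.
  have [-> /ivs->] // := flank_inj leaf_v zin zin' cz cz' phiE.
apply: allpairs_uniq_dep => //.
  move=> z _; rewrite /choices; case: op {leaf_v} => // p.
  by case: (p \in z.1) => //; case: (p \in z.2).
move=> _ _ /allpairsPdep[z [c [zin cz ->]]] /allpairsPdep[z' [c' [zin' cz' ->]]] /= [zE _].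
have [-> /ivs->] // := flank_inj leaf_v zin zin' cz cz' (congr1 phi zE).
Qed.

Lemma uniq_phi_enum_good vs : leaf_order e vs -> uniq [seq phi z.1 | z <- enum_good vs].
Proof. by case/enum_good_inj=> uvs ivs; rewrite map_inj_in_uniq. Qed.
End Distinct.

Lemma count_enum_good (f : pred (seq T * seq T)) v op vs :
  count f (enum_good ((v, op) :: vs)) =
  \sum_(z <- enum_good vs) count (fun c => f (flank v c z.1, mark v op c z.2)) (choices op z).
Proof.
rewrite [enum_good _]/(flatten [seq [seq (flank v c z.1, mark v op c z.2) | c <- choices op z]
  | z <- enum_good vs]) count_flatten sumnE !big_map.
by apply: eq_bigr => z _; rewrite count_map.
Qed.

Definition num_with p vs := count (fun z => p \in z.1) (enum_good vs).
Definition num_free p vs := count (fun z => (p \in z.1) && (p \notin z.2)) (enum_good vs).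

(** Leaving [v] out and putting it in front is always possible, putting it
behind requires [p], and putting it around requires [p] to be unmatched. *)
Lemma size_enum_good v p vs : size (enum_good ((v, Some p) :: vs)) =
  (size (enum_good vs)).*2 + num_with p vs + num_free p vs.
Proof.
rewrite -count_predT count_enum_good /num_with /num_free -!sumn_count !sumnE !big_map.
rewrite -addnn -!sum1_size -!big_split; apply: eq_bigr => z _ /=.
by rewrite /choices; case: (p \in z.1) => //; case: (p \in z.2).
Qed.

(** The words without the last vertex are the words of the previous list. *)
Lemma num_with_last v op vs : leaf_order e ((v, op) :: vs) ->
  num_with v ((v, op) :: vs) + size (enum_good vs) = size (enum_good ((v, op) :: vs)).
Proof.
move=> leaf_v; have [vvs _ lvs] := and3P leaf_v.
rewrite -[in RHS]count_predT /num_with !count_enum_good -sum1_size -big_split.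
rewrite !big_seq; apply: eq_bigr => z zin /=.
have [_ sz _] := enum_good_wf e_sym e_irr lvs zin.
have /negPf vz : v \notin z.1 by apply: contra vvs => /sz.
rewrite /choices /flank; case: op {leaf_v} => [p|] /=; last by rewrite ?cats0 ?inE ?eqxx ?vz.
case: (p \in z.1); last by rewrite /= !cats0 ?inE ?eqxx vz.
by case: (p \in z.2); rewrite /= !cats0 !mem_cat ?inE ?eqxx vz ?mem_cat ?inE ?eqxx ?orbT.
Qed.

(** The last vertex is unmatched when it is put in front or behind. *)
Lemma num_free_last v p vs : leaf_order e ((v, Some p) :: vs) ->
  num_free v ((v, Some p) :: vs) = size (enum_good vs) + num_with p vs.
Proof.
move=> leaf_v; have [vvs _ lvs] := and3P leaf_v.
rewrite /num_with /num_free count_enum_good -sum1_size -sumn_count sumnE big_map -big_split.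
rewrite !big_seq; apply: eq_bigr => z zin /=.
have [_ sz mz] := enum_good_wf e_sym e_irr lvs zin.
have /negPf vz : v \notin z.1 by apply: contra vvs => /sz.
have /negPf vm : v \notin z.2.
  apply/negP=> /mz[j] /andP[_ /orP[]] /mem_subseq/(_ v);
  by rewrite !inE eqxx ?orbT vz => /(_ isT).
rewrite /choices /flank /mark /=.
case: (p \in z.1); last by rewrite /= !cats0 ?inE ?eqxx vz vm.
by case: (p \in z.2); rewrite /= !cats0 !mem_cat ?inE ?eqxx vz vm ?mem_cat ?inE ?eqxx ?orbT.
Qed.

(** Let S, P, Q denote the numbers of all words, of words containing the last
vertex, and of words in which it is moreover unmatched, with an index for the
number of added vertices.  Then S3 = 2 S2 + P2 + Q2, with P2 = S2 - S1,
Q2 = S1 + P1 and P1 = S1 - S0; the recurrence follows. *)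
Lemma size_enum_good_rec v3 v2 v1 p vs :
  let vs1 := (v1, p) :: vs in let vs2 := (v2, Some v1) :: vs1 in
  let vs3 := (v3, Some v2) :: vs2 in leaf_order e vs2 ->
  size (enum_good vs3) + size (enum_good vs) =
  3 * size (enum_good vs2) + size (enum_good vs1).
Proof.
move=> vs1 vs2 vs3 l2; have l1 : leaf_order e vs1 by case/and3P: l2.
have E3 := size_enum_good v3 v2 vs2; have E2 := num_with_last l2.
have F2 := num_free_last l2; have E1 := num_with_last l1.
rewrite -/vs1 -/vs2 -/vs3 in E1 E2 E3 F2 *; lia.
Qed.
End Counting.

Lemma enum_good_cons (T : eqType) v op (vs : seq (T * option T)) :
  enum_good ((v, op) :: vs) =
  [seq (flank v c z.1, mark v op c z.2) | z <- enum_good vs, c <- choices op z].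
Proof. by []. Qed.

Section Transport.
Variables (T T' : eqType) (g : T -> T') (e : rel T) (e' : rel T').
Hypotheses (g_inj : injective g) (eg : forall x y, e x y = e' (g x) (g y)).

Definition map_vs (vs : seq (T * option T)) := [seq (g v.1, omap g v.2) | v <- vs].

Lemma unzip1_map_vs vs : unzip1 (map_vs vs) = map g (unzip1 vs).
Proof. by rewrite /unzip1 /map_vs -!map_comp. Qed.

Lemma leaf_order_map vs : leaf_order e' (map_vs vs) = leaf_order e vs.
Proof.
elim: vs => //= -[v op] vs IH /=; rewrite IH unzip1_map_vs mem_map // all_map.
congr [&& _, _ & _]; apply: eq_all => x /=; rewrite eg; congr (_ == _).
by case: op => [p|] //=; apply/eqP/eqP => [[/g_inj->]|[->]].
Qed.

Lemma enum_good_map vs :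
  enum_good (map_vs vs) = [seq (map g z.1, map g z.2) | z <- enum_good vs].
Proof.
elim: vs => // -[v op] vs IH.
rewrite -[map_vs _]/((g v, omap g op) :: map_vs vs) !enum_good_cons IH.
rewrite allpairs_mapl map_allpairs.
have -> : [seq (flank (g v) c (map g z.1, map g z.2).1,
      mark (g v) (omap g op) c (map g z.1, map g z.2).2)
    | z <- enum_good vs, c <- choices (omap g op) (map g z.1, map g z.2)] =
  [seq (flank (g v) c (map g z.1), mark (g v) (omap g op) c (map g z.2))
    | z <- enum_good vs, c <- choices op z].
  apply: eq_allpairsr => z; rewrite /choices; case: (op) => //= p.
  by rewrite !mem_map.
apply: eq_allpairs => z -[c d]; rewrite /flank /mark !map_cat; congr (_, _).
  by case: c; case: d.
by case: op => // p; case: c; case: d.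
Qed.

(** The numbers of words are computed with natural numbers as vertices and used
for vertices in ordinal types. *)
Lemma size_enum_good_map vs : size (enum_good (map_vs vs)) = size (enum_good vs).
Proof. by rewrite enum_good_map size_map. Qed.
End Transport.

(** * Length in simply laced Coxeter groups *)

Section Length.
Local Open Scope nat_scope.
Variables (n : nat) (G : coxgraph n).
Local Notation W := (coxgroup G).
Local Notation s := (cox_gen G).
Local Notation word := (cox_word G).
Local Notation len := (@cox_length n G).
Implicit Types (i j : 'I_n) (u v : seq 'I_n) (w x y : W).

Lemma cox_word_cat u v : word (u ++ v) = (word u * word v)%g.
Proof. by rewrite /cox_word big_cat. Qed.

Lemma cox_word1 i : word [:: i] = s i.
Proof. by rewrite /cox_word big_seq1. Qed.

Lemma cox_word_rcons u i : word (rcons u i) = (word u * s i)%g.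
Proof. by rewrite -cats1 cox_word_cat cox_word1. Qed.

Lemma cox_word_cong u v : coxcong G u v -> word u = word v.
Proof. by move=> uv; rewrite !cox_wordE; apply/coxgroup_eqP. Qed.

Lemma cox_gen_sq i : (s i * s i = 1)%g.
Proof.
have := cox_word_cong (coxcong_rel G i i); rewrite /coxm eqxx.
by rewrite -[flatten _]/([:: i] ++ [:: i]) cox_word_cat !cox_word1 /cox_word big_nil.
Qed.

Lemma cox_mulKgen w i : (w * s i * s i = w)%g.
Proof. by rewrite -mulgA cox_gen_sq mulg1. Qed.

Lemma cox_gen_commute i j : i != j -> ~~ G i j -> (s i * s j = s j * s i)%g.
Proof.
move=> ij nij; have := cox_word_cong (coxcong_rel G i j).
rewrite /coxm (negPf ij) (negPf nij) -[flatten _]/([:: i] ++ [:: j] ++ [:: i] ++ [:: j]).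
rewrite !cox_word_cat !cox_word1 [RHS]/cox_word big_nil => E.
by apply: (mulIg (s i)); apply: (mulIg (s j)); rewrite cox_mulKgen cox_gen_sq -!mulgA.
Qed.

Lemma cox_gen_braid i j : G i j -> (s i * s j * s i = s j * s i * s j)%g.
Proof.
move=> Gij; have ij : i != j by apply: contraTneq Gij => ->; rewrite adj_irr.
have := cox_word_cong (coxcong_rel G i j); rewrite /coxm (negPf ij) Gij.
rewrite -[flatten _]/([:: i] ++ [:: j] ++ [:: i] ++ [:: j] ++ [:: i] ++ [:: j]).
rewrite !cox_word_cat !cox_word1 [RHS]/cox_word big_nil => E.
apply: (mulIg (s j)); apply: (mulIg (s i)); apply: (mulIg (s j)).
by rewrite !cox_mulKgen cox_gen_sq -!mulgA.
Qed.

Lemma cox_word_braid_eq u v : braid_eq G u v -> word u = word v.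
Proof.
elim=> // {}v w _ -> [a b i j ij nij|a b i j Gij].
  by rewrite !cox_word_cat !(@cox_word_cat [:: _] [:: _]) !cox_word1 cox_gen_commute.
by rewrite !cox_word_cat !(@cox_word_cat [:: _] [:: _; _]) !(@cox_word_cat [:: _] [:: _])
  !cox_word1 2![(s _ * (s _ * _))%g]mulgA cox_gen_braid.
Qed.

Definition reducedb u := len (word u) == size u.

Lemma cox_length_le u : len (word u) <= size u.
Proof.
by rewrite /cox_length; case: ex_minnP => k _; apply; apply/asboolP; exists u.
Qed.

Lemma reducedb_exists w : exists2 u, word u = w & reducedb u.
Proof.
have [u uw su] : exists2 u, word u = w & size u = len w.
  by rewrite /cox_length; case: ex_minnP => k /asboolP[u uw uk] _; exists u.
by exists u => //; rewrite /reducedb uw su.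
Qed.

Lemma reducedE u w : reduced u w <-> word u = w /\ reducedb u.
Proof.
split=> [[uw su]|[uw /eqP ru]]; first by split=> //; rewrite /reducedb uw su.
by split=> //; rewrite -uw ru.
Qed.

Lemma cox_length_mul x y : len (x * y)%g <= len x + len y.
Proof.
have [u <- /eqP->] := reducedb_exists x; have [v <- /eqP->] := reducedb_exists y.
by rewrite -cox_word_cat -size_cat cox_length_le.
Qed.

Lemma reducedb_catr u v : reducedb (u ++ v) -> reducedb v.
Proof.
rewrite /reducedb !eqn_leq !cox_length_le /= size_cat cox_word_cat => h.
by have := leq_trans h (cox_length_mul _ _); have := cox_length_le u; lia.
Qed.

Lemma reducedb_catl u v : reducedb (u ++ v) -> reducedb u.
Proof.
rewrite /reducedb !eqn_leq !cox_length_le /= size_cat cox_word_cat => h.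
by have := leq_trans h (cox_length_mul _ _); have := cox_length_le v; lia.
Qed.

(** All defining relators have even length, which gives the sign character. *)
Lemma odd_coxcong u v : coxcong G u v -> odd (size u) = odd (size v).
Proof.
elim=> {u v} [u|u v _ ->|v u w _ -> _ ->|a b u v _ IH|i j] //.
  by rewrite !size_cat !oddD IH.
by rewrite size_flatten /shape map_nseq sumn_nseq /= oddM.
Qed.

Lemma odd_cox_length u : odd (len (word u)) = odd (size u).
Proof.
have [v uv /eqP rv] := reducedb_exists (word u); rewrite -uv rv.
by apply: odd_coxcong; apply/coxgroup_eqP; rewrite -!cox_wordE.
Qed.

Lemma cox_length1 i : len (s i) <= 1.
Proof. by rewrite -cox_word1 (cox_length_le [:: i]). Qed.

(** The two lengths differ by at most one, and they have different parities. *)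
Lemma cox_length_mulgen w i : len (w * s i)%g = (len w).+1 \/ len w = (len (w * s i)%g).+1.
Proof.
have h1 := cox_length_mul w (s i); have h2 := cox_length_mul (w * s i)%g (s i).
rewrite cox_mulKgen in h2; have h3 := cox_length1 i.
have : odd (len (w * s i)%g) != odd (len w).
  have [u <- _] := reducedb_exists w.
  by rewrite -cox_word_rcons !odd_cox_length size_rcons /=; case: (odd _).
move=> oddn; have : len (w * s i)%g != len w by apply: contraNneq oddn => ->.
lia.
Qed.

Lemma descent_exists w : w <> 1%g -> exists i, len w = (len (w * s i)%g).+1.
Proof.
have [u <- ru] := reducedb_exists w; case/lastP: u ru => [|u i] ru;
  first by rewrite /cox_word big_nil.
move=> _; exists i; rewrite cox_word_rcons cox_mulKgen -cox_word_rcons (eqP ru) size_rcons.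
by move: ru; rewrite -cats1 => /reducedb_catl/eqP->.
Qed.

Lemma reducedb_rcons u i : reducedb u ->
  reducedb (rcons u i) = (len (word u * s i)%g == (len (word u)).+1).
Proof. by move=> /eqP ru; rewrite /reducedb cox_word_rcons size_rcons ru. Qed.
End Length.

(** * The geometric representation and the word theorems *)

Section Geometry.
Variables (R : realType) (n : nat) (G : coxgraph n).
Local Notation W := (coxgroup G).
Local Notation V := 'rV[R]_n.
Local Notation s := (cox_gen G).
Local Notation word := (cox_word G).
Local Notation len := (@cox_length n G).
Local Notation al := (@simple_root R n).
Local Notation act := (@cox_act R n G).
Local Notation rf := (@refl R n G).
Implicit Types (i j : 'I_n) (u v : seq 'I_n) (w x y : W).

Definition nonneg (r : V) := forall k, 0 <= r 0 k.

Lemma refl_linear i a (x y : V) : rf i (a *: x + y) = a *: rf i x + rf i y.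
Proof.
rewrite /refl cox_formDl cox_formZl.
by apply/rowP => k; rewrite !mxE; ring.
Qed.

Lemma word_act_linear u a (x y : V) :
  word_act G u (a *: x + y) = a *: word_act G u x + word_act G u y.
Proof. by elim: u => //= i u IH; rewrite IH refl_linear. Qed.

Lemma word_actD u (x y : V) : word_act G u (x + y) = word_act G u x + word_act G u y.
Proof. by have := word_act_linear u 1 x y; rewrite !scale1r. Qed.

Lemma word_act0 u : word_act G u (0 : V) = 0.
Proof. by apply: (addrI (word_act G u 0)); rewrite -word_actD !addr0. Qed.

Lemma word_actN u (x : V) : word_act G u (- x) = - word_act G u x.
Proof. by apply/eqP; rewrite -addr_eq0 -word_actD addNr word_act0. Qed.

Lemma cox_actD w (x y : V) : act w (x + y) = act w x + act w y.
Proof. exact: word_actD. Qed.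

Lemma cox_actN w (x : V) : act w (- x) = - act w x.
Proof. exact: word_actN. Qed.

Lemma refl_self i : rf i (al i) = - al i.
Proof.
by rewrite /refl cox_form_diag mulr1 scaler_nat mulr2n opprD addrA subrr sub0r.
Qed.

Lemma refl_adj i j : G i j -> rf i (al j) = al j + al i.
Proof.
move=> Gij; have ji : j != i by apply: contraTneq Gij => ->; rewrite adj_irr.
rewrite /refl cox_form_off // adj_sym Gij.
by apply/rowP => k; rewrite !mxE; field.
Qed.

Lemma refl_nadj i j : i != j -> ~~ G i j -> rf i (al j) = al j.
Proof.
move=> ij nij; rewrite /refl cox_form_off 1?eq_sym // adj_sym (negPf nij).
by rewrite mulr0 scale0r subr0.
Qed.

Lemma cox_act_mulgen w i (x : V) : act (w * s i)%g x = act w (rf i x).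
Proof. by rewrite cox_actM cox_act_gen. Qed.

Lemma nonnegD (x y : V) : nonneg x -> nonneg y -> nonneg (x + y).
Proof. by move=> px py k; rewrite mxE addr_ge0. Qed.

Lemma nonneg_simple i : nonneg (al i).
Proof. by move=> k; rewrite /simple_root mxE; case: (_ && _). Qed.

Lemma simple_root_neq0 i : al i != 0.
Proof. by apply/eqP => /rowP/(_ i)/eqP; rewrite !mxE !eqxx oner_eq0. Qed.

Lemma cox_act_neq0 w (x : V) : x != 0 -> act w x != 0.
Proof.
apply: contraNneq => wx; rewrite -[x](@cox_act1 R n G) -(mulVg w) cox_actM wx.
by rewrite /cox_act word_act0.
Qed.

Lemma nonneg_anti (x : V) : nonneg x -> nonneg (- x) -> x = 0.
Proof.
move=> px nx; apply/rowP => k; have := px k; have := nx k; rewrite !mxE oppr_ge0 => h1 h2.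
by apply/eqP; rewrite eq_le h1 h2.
Qed.

(** The link between length and positivity.  By induction on the length:
write w = w' t with w' shorter.  If t is not adjacent to i, it fixes the simple
root of i.  Otherwise w maps the simple root of i to the sum of the images under
w' of the simple roots of t and i; either both are nonnegative by induction, or
w' = w2 i with w2 shorter and the sum is the image under w2 of the simple root
of t. *)
Lemma ascent_nonneg w i : (len w < len (w * s i)%g)%N -> nonneg (act w (al i)).
Proof.
move: {2}(len w) (erefl (len w)) => k; elim/ltn_ind: k w i => k IH w i wk asc.
have [->|/eqP w1] := eqVneq w 1%g; first by rewrite cox_act1; apply: nonneg_simple.
have [t wt] := descent_exists w1; pose w' : W := (w * s t)%g.
have w'E : (w' * s t = w)%g by rewrite /w' cox_mulKgen.
have lw' : len w = (len w').+1 by [].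
have ti : t != i by apply: contraTneq asc => <-; rewrite wt; lia.
have pt : nonneg (act w' (al t)) by apply: (IH (len w')); rewrite ?w'E; lia.
rewrite -w'E cox_act_mulgen; have [Gti|nGti] := boolP (G t i); last first.
  rewrite refl_nadj //; apply: (IH (len w')); [lia| by []|].
  have [->//|asc'] := cox_length_mulgen w' i.
  have wsi : (w * s i = w' * s i * s t)%g by rewrite -w'E -!mulgA cox_gen_commute.
  by have := cox_length_mul (w' * s i)%g (s t); have := cox_length1 G t; rewrite -wsi; lia.
rewrite refl_adj // cox_actD; have [asc'|desc'] := cox_length_mulgen w' i.
  by apply: nonnegD => //; apply: (IH (len w')); lia.
pose w2 : W := (w' * s i)%g; have w2E : (w2 * s i = w')%g by rewrite /w2 cox_mulKgen.
have lw2 : len w' = (len w2).+1 by [].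
rewrite -cox_actD -w2E cox_act_mulgen addrC.
have -> : rf i (al t + al i) = al t.
  have := refl_linear i 1 (al t) (al i); rewrite !scale1r => ->.
  by rewrite refl_self refl_adj 1?adj_sym // addrK.
apply: (IH (len w2)); [lia| by []|].
have [->//|desc2] := cox_length_mulgen w2 t.
(* if t were a descent of w2, this equality would make w s_i shorter than w *)
have wsi : (w * s i = w2 * s t * s i * s t)%g.
  have Git : G i t by rewrite adj_sym.
  by have := congr1 (fun x => w2 * x)%g (cox_gen_braid Git); rewrite !mulgA w2E w'E.
have := cox_length_mul (w2 * s t * s i)%g (s t); have := cox_length_mul (w2 * s t)%g (s i).
by rewrite -wsi; have := cox_length1 G t; have := cox_length1 G i; lia.
Qed.

Lemma descent_nonpos w i : (len (w * s i)%g < len w)%N -> nonneg (- act w (al i)).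
Proof.
move=> desc; rewrite -cox_actN -refl_self -cox_act_mulgen; apply: ascent_nonneg.
by rewrite cox_mulKgen.
Qed.

(** A sign determines the length comparison, because the image of a simple
root is never zero. *)
Lemma descentP w i : nonneg (- act w (al i)) -> len w = (len (w * s i)%g).+1.
Proof.
move=> neg; have [asc|//] := cox_length_mulgen w i.
have pos : nonneg (act w (al i)) by apply: ascent_nonneg; rewrite asc.
by have /eqP[] := cox_act_neq0 w (simple_root_neq0 i); apply: nonneg_anti.
Qed.

(** Two reduced words of w ending in different letters i and j show that both are
descents of w.  By [descentP] w then has a reduced word ending in the longest
word on i and j, in either of its two forms, and induction compares each given
word with one of them. *)
Theorem matsumoto u v : reducedb G u -> reducedb G v -> word u = word v -> braid_eq G u v.
Proof.
move: {2}(size u) (erefl (size u)) => k; elim/ltn_ind: k u v => k IH u v uk ru rv uv.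
have suv : size v = size u by rewrite -(eqP ru) uv (eqP rv).
case/lastP: u uk ru uv suv => [|u i] uk ru uv suv.
  by case: v suv {uv rv} => // _; left.
case/lastP: v rv uv suv => [|v j] rv uv suv; first by rewrite size_rcons in suv.
rewrite !size_rcons in suv uk; case: suv => suv.
have ru' : reducedb G u by move: ru; rewrite -cats1 => /reducedb_catl.
have rv' : reducedb G v by move: rv; rewrite -cats1 => /reducedb_catl.
have ub b : braid_eq G u b -> braid_eq G (rcons u i) (b ++ [:: i]).
  by move=> /(braid_eq_catr [:: i]); rewrite cats1.
have vb b : braid_eq G v b -> braid_eq G (rcons v j) (b ++ [:: j]).
  by move=> /(braid_eq_catr [:: j]); rewrite cats1.
have [ij|ij] := eqVneq i j.
  rewrite -cats1 -[rcons v j]cats1 ij; apply/braid_eq_catr/(IH (size u)) => //; first lia.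
  by move: uv; rewrite !cox_word_rcons ij => /mulIg.
pose w := word (rcons u i).
have lw : len w = k by rewrite (eqP ru) size_rcons.
have wi : (w * s i)%g = word u by rewrite /w cox_word_rcons cox_mulKgen.
have wj : (w * s j)%g = word v by rewrite /w uv cox_word_rcons cox_mulKgen.
have ni : nonneg (- act w (al i)) by apply: descent_nonpos; rewrite wi (eqP ru') lw; lia.
have nj : nonneg (- act w (al j)) by apply: descent_nonpos; rewrite wj (eqP rv') lw; lia.
have li : len (w * s i)%g = size u by rewrite wi (eqP ru').
have [Gij|nGij] := boolP (G i j).
  have Gji : G j i by rewrite adj_sym.
  have l2 : len (w * s i)%g = (len (w * s i * s j)%g).+1.
    by apply: descentP; rewrite cox_act_mulgen refl_adj // cox_actD opprD; apply: nonnegD.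
  have l3 : len (w * s i * s j)%g = (len (w * s i * s j * s i)%g).+1.
    apply: descentP; rewrite !cox_act_mulgen refl_adj //.
    have := refl_linear i 1 (al i) (al j); rewrite !scale1r => ->.
    by rewrite refl_self refl_adj // addrC addrK.
  (* t ++ [:: i; j; i] and t ++ [:: j; i; j] are reduced words of w *)
  have [t tE rt] := reducedb_exists (w * s i * s j * s i)%g; move: (eqP rt); rewrite tE => lt.
  have uE : word u = word (t ++ [:: i; j]).
    by rewrite -[_ ++ _]/(t ++ [:: i] ++ [:: j]) !cox_word_cat !cox_word1 tE mulgA !cox_mulKgen.
  have vE : word v = word (t ++ [:: j; i]).
    rewrite -[_ ++ _]/(t ++ [:: j] ++ [:: i]) !cox_word_cat !cox_word1 tE -wj mulgA.
    have := congr1 (fun x => w * x)%g (cox_gen_braid Gij).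
    by rewrite !mulgA => ->; rewrite !cox_mulKgen.
  have ut : braid_eq G u (t ++ [:: i; j]).
    apply: (IH (size u)) => //; first lia.
    by rewrite /reducedb -uE (eqP ru') size_cat /=; lia.
  have vt : braid_eq G v (t ++ [:: j; i]).
    apply: (IH (size v)) => //; first lia.
    by rewrite /reducedb -vE (eqP rv') size_cat /=; lia.
  apply: braid_eq_trans (ub _ ut) _; apply: (braid_eq_sym (@adj_sym _ G)).
  apply: braid_eq_trans (vb _ vt) _; rewrite -!catA /=.
  exact: braid_move_braid_eq (braid_move_braid t [::] Gji).
have l2 : len (w * s i)%g = (len (w * s i * s j)%g).+1.
  by apply: descentP; rewrite cox_act_mulgen refl_nadj.
(* t ++ [:: j; i] and t ++ [:: i; j] are reduced words of w *)
have [t tE rt] := reducedb_exists (w * s i * s j)%g; move: (eqP rt); rewrite tE => lt.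
have uE : word u = word (t ++ [:: j]).
  by rewrite cox_word_cat cox_word1 tE cox_mulKgen.
have vE : word v = word (t ++ [:: i]).
  rewrite cox_word_cat cox_word1 tE -wj -!mulgA -(cox_gen_commute ij nGij).
  by rewrite !mulgA cox_mulKgen.
have ut : braid_eq G u (t ++ [:: j]).
  by apply: (IH (size u)); rewrite // ?/reducedb -?uE ?(eqP ru') ?size_cat /=; lia.
have vt : braid_eq G v (t ++ [:: i]).
  by apply: (IH (size v)); rewrite // ?/reducedb -?vE ?(eqP rv') ?size_cat /=; lia.
apply: braid_eq_trans (ub _ ut) _; apply: (braid_eq_sym (@adj_sym _ G)).
apply: braid_eq_trans (vb _ vt) _; rewrite -!catA /=.
exact: braid_move_braid_eq (braid_move_comm t [::] ij nGij).
Qed.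

(** Take the shortest nonreduced prefix u i: the element of u has a reduced
word ending in i, to which u is braid equivalent by [matsumoto]. *)
Lemma nonreduced_braid_eq u : ~~ reducedb G u -> exists a i b, braid_eq G u (a ++ [:: i; i] ++ b).
Proof.
elim/last_ind: u => [|u i IH]; first by rewrite /reducedb -leqn0 cox_length_le.
have [ru|nru _] := boolP (reducedb G u); last first.
  have [a [j [b ub]]] := IH nru; exists a, j, (b ++ [:: i]).
  by rewrite -cats1; have := braid_eq_catr [:: i] ub; rewrite -!catA.
rewrite reducedb_rcons // => nred; have [asc|desc] := cox_length_mulgen (word u) i.
  by rewrite asc eqxx in nred.
have [t tE rt] := reducedb_exists (word u * s i)%g.
exists t, i, [::]; rewrite -cats1 -[_ ++ [:: i; i] ++ _]/(t ++ [:: i] ++ [:: i]) catA.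
apply: braid_eq_catr; have tuE : word (t ++ [:: i]) = word u by rewrite cox_word_cat cox_word1 tE cox_mulKgen.
apply: matsumoto => //; rewrite /reducedb tuE desc size_cat addn1 -tE.
by rewrite (eqP rt).
Qed.
End Geometry.

(** * Root sequences and contractible triples *)

Section RootSequences.
Variables (R : realType) (n : nat) (G : coxgraph n).
Local Notation W := (coxgroup G).
Local Notation V := 'rV[R]_n.
Local Notation s := (cox_gen G).
Local Notation word := (cox_word G).
Local Notation len := (@cox_length n G).
Local Notation al := (@simple_root R n).
Local Notation act := (@cox_act R n G).
Local Notation rf := (@refl R n G).
Local Notation wact := (@word_act R n G).
Local Notation reducedb := (@reducedb n G).
Implicit Types (i j k : 'I_n) (u v a b : seq 'I_n) (w : W) (r : V).

Lemma cox_word_rev u : word (rev u) = ((word u)^-1)%g.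
Proof.
elim: u => [|i u IH]; first by rewrite /cox_word !big_nil invg1.
rewrite rev_cons cox_word_rcons IH -cat1s cox_word_cat cox_word1 invgM; congr (_ * _)%g.
by apply: (mulIg (s i)); rewrite cox_gen_sq mulVg.
Qed.

Lemma reducedb_rev u : reducedb (rev u) = reducedb u.
Proof.
have h v : reducedb v -> reducedb (rev v).
  rewrite /reducedb size_rev => /eqP rv;
    rewrite eqn_leq -[X in (_ <= X)%N]size_rev cox_length_le /=.
  rewrite -rv; have [t tE /eqP rt] := reducedb_exists (word (rev v)).
  have -> : word v = word (rev t) by rewrite cox_word_rev tE cox_word_rev invgK.
  by rewrite -tE rt -[X in (_ <= X)%N]size_rev cox_length_le.
by apply/idP/idP => /h; rewrite ?revK.
Qed.

Definition lact a (e : 'I_n * V) := (e.1, wact a e.2).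

(** The roots s_{i_1} ... s_{i_{k-1}} (alpha_{i_k}) of a word i_1 i_2 ..., each
with its letter i_k.  For the reversal of a reduced word of w they form the
root sequence of w ([root_seqE]); working with reversed words makes the
definition recursive. *)
Fixpoint lroots v : seq ('I_n * V) :=
  if v is i :: v' then (i, al i) :: map (lact [:: i]) (lroots v') else [::].

Definition vroots v := unzip2 (lroots v).

Lemma lroots_cat a b : lroots (a ++ b) = lroots a ++ map (lact a) (lroots b).
Proof.
elim: a => [|i a IH] /=; first by rewrite map_id_in // => -[].
by rewrite IH map_cat -map_comp; congr (_ :: _ ++ _); exact: eq_map.
Qed.

Lemma unzip1_lroots v : unzip1 (lroots v) = v.
Proof. by elim: v => //= i v {2}<-; congr (_ :: _); rewrite /unzip1 -map_comp. Qed.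

Lemma size_lroots v : size (lroots v) = size v.
Proof. by rewrite -[in RHS](unzip1_lroots v) size_map. Qed.

Lemma size_vroots v : size (vroots v) = size v.
Proof. by rewrite size_map size_lroots. Qed.

Lemma vroots_cat a b : vroots (a ++ b) = vroots a ++ map (wact a) (vroots b).
Proof. by rewrite /vroots lroots_cat /unzip2 map_cat -!map_comp. Qed.

(** The induction needs a prefix [p] that has already been read. *)
Lemma root_seqE u : root_seq R G u = vroots (rev u).
Proof.
rewrite /root_seq -[size u]size_rev.
have H p v : [seq act (word (take ki.1 (p ++ v))) (al ki.2)
    | ki <- zip (iota (size p) (size v)) v] = map (wact p) (vroots v).
  elim: v p => //= i v IH p; rewrite take_size_cat // cox_act_word; congr (_ :: _).
  have := IH (rcons p i); rewrite size_rcons cat_rcons => ->.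
  rewrite /vroots /unzip2 -!map_comp; apply: eq_map => e /=.
  by rewrite -cats1 word_act_cat.
have := H [::] (rev u); rewrite /= => ->; exact: map_id.
Qed.

Lemma lrootsP v k r : (k, r) \in lroots v ->
  exists a b, v = a ++ k :: b /\ r = wact a (al k).
Proof.
elim: v r => //= i v IH r; rewrite inE => /orP[/eqP[-> ->]|]; first by exists [::], v.
case/mapP=> -[k' r'] kr' [kk' rr']; rewrite -{}kk' in kr'.
have [a [b [-> r'E]]] := IH _ kr'; exists (i :: a), b; split=> //.
by rewrite rr' r'E.
Qed.

Lemma vrootsP v r : r \in vroots v -> exists a i b, v = a ++ i :: b /\ r = wact a (al i).
Proof. by case/mapP=> -[k r'] /lrootsP[a [b [? ?]]] /= ->; exists a, k, b. Qed.

Lemma lroots_vroots v k r : (k, r) \in lroots v -> r \in vroots v.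
Proof. by move=> kr; apply/mapP; exists (k, r). Qed.

Lemma lroots_mem v k r : (k, r) \in lroots v -> k \in v.
Proof. by move=> kr; rewrite -(unzip1_lroots v); apply/mapP; exists (k, r). Qed.

Lemma mem_lroots v k : k \in v -> exists r, (k, r) \in lroots v.
Proof. by rewrite -{1}(unzip1_lroots v) => /mapP[-[k' r] kr /= ->]; exists r. Qed.

Lemma word_act_nonneg v i : reducedb (rcons v i) -> nonneg (wact v (al i)).
Proof.
move=> rvi; rewrite -cox_act_word; apply: ascent_nonneg.
rewrite -cox_word_rcons (eqP rvi) size_rcons.
by move: rvi; rewrite -cats1 => /reducedb_catl/eqP->.
Qed.

Lemma vroots_nonneg v r : reducedb v -> r \in vroots v -> nonneg r.
Proof.
move=> rv /vrootsP[a [i [b [vE ->]]]]; move: rv; rewrite vE -cat_rcons => /reducedb_catl.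
exact: word_act_nonneg.
Qed.

Lemma word_act_neq0 v r : r != 0 -> wact v r != 0.
Proof. by move=> r0; rewrite -cox_act_word cox_act_neq0. Qed.

Lemma vroots_neq0 v r : r \in vroots v -> r != 0.
Proof. by case/vrootsP=> [a [i [b [_ ->]]]]; rewrite word_act_neq0 // simple_root_neq0. Qed.

Lemma word_actKrev v r : wact (rev v) (wact v r) = r.
Proof. by rewrite -!cox_act_word -cox_actM cox_word_rev mulVg cox_act1. Qed.

Lemma word_act_inj v : injective (wact v).
Proof. exact: can_inj (word_actKrev v). Qed.

(** A repeated root would make a simple root the opposite of a nonnegative
root of a reduced word. *)
Lemma uniq_vroots v : reducedb v -> uniq (vroots v).
Proof.
elim: v => // i v IH rv; have rv' : reducedb v by move: rv; rewrite -cat1s => /reducedb_catr.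
rewrite -[i :: v]/([:: i] ++ v) vroots_cat /= map_inj_uniq ?IH // ?andbT;
  last exact: (@word_act_inj [:: i]).
apply/negP=> /mapP[r rin] /(congr1 (wact [:: i])).
have -> : wact [:: i] (wact [:: i] r) = r by apply: (word_actKrev [:: i]).
rewrite /= refl_self => rE; have rn := vroots_nonneg rv' rin.
by have /eqP := vroots_neq0 rin; apply; apply: nonneg_anti => //; rewrite -rE opprK;
  apply: nonneg_simple.
Qed.

Lemma lroots_fun v k k' r : reducedb v -> (k, r) \in lroots v -> (k', r) \in lroots v -> k = k'.
Proof.
move=> /uniq_vroots uv kin kin'; have := uv; rewrite /vroots.
elim: (lroots v) kin kin' => //= -[l x] L IH; rewrite !inE => /orP[/eqP[-> ->]|kin].
  case/orP=> [/eqP[->]//|k'in] /andP[/negP[]].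
  by apply/mapP; exists (k', x).
case/orP=> [/eqP[-> xE]|k'in] /andP[xL uL]; last exact: IH.
by case/negP: xL; apply/mapP; exists (k, r).
Qed.

Lemma uniq_lroots v : reducedb v -> uniq (lroots v).
Proof. by move/uniq_vroots/map_uniq. Qed.

Lemma lroots_comm a b i j : i != j -> ~~ G i j ->
  exists A B r t, lroots (a ++ [:: i; j] ++ b) = A ++ [:: (i, r); (j, t)] ++ B /\
                  lroots (a ++ [:: j; i] ++ b) = A ++ [:: (j, t); (i, r)] ++ B.
Proof.
move=> ij nij; exists (lroots a), (map (lact (a ++ [:: i;
  j])) (lroots b)), (wact a (al i)), (wact a (al j)).
split; rewrite !lroots_cat /= -!map_comp /lact /=.
  rewrite refl_nadj //; congr (_ ++ _ :: _ :: _); apply: eq_map => e /=.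
  by rewrite word_act_cat.
rewrite refl_nadj 1?eq_sym 1?adj_sym //; congr (_ ++ _ :: _ :: _); apply: eq_map => e /=.
rewrite word_act_cat; congr (_, wact a _).
have E : word [:: j; i] = word [:: i; j].
  exact/esym/(cox_word_braid_eq (braid_move_braid_eq (braid_move_comm [::] [::] ij nij))).
by rewrite -[LHS]/(wact [:: j; i] e.2) -[RHS]/(wact [:: i; j] e.2) -!cox_act_word E.
Qed.

(** The middle root is the same because s_i maps alpha_j, and s_j maps alpha_i,
to alpha_i + alpha_j; the outer roots are exchanged because s_i s_j maps alpha_i
to alpha_j. *)
Lemma lroots_braid a b i j : G i j ->
  let r := wact a (al i) in let t := wact a (al j) in
  let B := map (lact (a ++ [:: i; j; i])) (lroots b) in
  lroots (a ++ [:: i; j; i] ++ b) = lroots a ++ [:: (i, r); (j, r + t); (i, t)] ++ B /\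
  lroots (a ++ [:: j; i; j] ++ b) = lroots a ++ [:: (j, t); (i, r + t); (j, r)] ++ B.
Proof.
move=> Gij r t B; have Gji : G j i by rewrite adj_sym.
have far k l : G k l -> rf k (rf l (al k)) = al l.
  move=> Gkl; rewrite refl_adj 1?adj_sym //.
  have := refl_linear G k 1 (al k) (al l); rewrite !scale1r => ->.
  by rewrite refl_self refl_adj // addrCA addNr addr0.
split; rewrite !lroots_cat /= -!map_comp /lact /=.
  rewrite far // refl_adj // word_actD [wact a _ + _]addrC.
  congr (_ ++ _ :: _ :: _ :: _); apply: eq_map => e.
  by rewrite /lact /= word_act_cat.
rewrite far // refl_adj // word_actD.
congr (_ ++ _ :: _ :: _ :: _); apply: eq_map => e.
rewrite /lact /= word_act_cat; congr (_, wact a _).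
have E : word [:: j; i; j] = word [:: i; j; i].
  exact: cox_word_braid_eq (braid_move_braid_eq (braid_move_braid [::] [::] Gji)).
by rewrite -[LHS]/(wact [:: j; i; j] e.2) -[RHS]/(wact [:: i; j; i] e.2) -!cox_act_word E.
Qed.

Definition braid_triple v (T : set V) := exists a i j b, [/\ v = a ++ [:: i; j; i] ++ b, G i j &
  T = [set wact a (al i); wact a (al i) + wact a (al j); wact a (al j)]].

Lemma vroots_inversions v r : reducedb v -> r \in vroots v -> inversions (word (rev v)) r.
Proof.
move=> rv rin; have [a [i [b [vE rE]]]] := vrootsP rin; split.
  split; last exact: vroots_nonneg rin.
  by exists (word a), i; rewrite cox_act_word.
exists (act (word (rev v)) r); last by rewrite -cox_actM mulVg cox_act1.
exists (wact (rev b) (al i)).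
  split; first by exists (word (rev b)), i; rewrite cox_act_word.
  apply: word_act_nonneg; rewrite -rev_cons reducedb_rev.
  by move: rv; rewrite vE => /reducedb_catr.
rewrite cox_act_word vE rev_cat rev_cons -cats1 !word_act_cat rE word_actKrev /=.
by rewrite refl_self word_actN.
Qed.

Lemma refl_coord i k r : k != i -> (rf i r) 0 k = r 0 k.
Proof. by move=> /negPf ki; rewrite /refl !mxE ki andbF mulr0 subr0. Qed.

Lemma reducedb_nosq a i b : reducedb (a ++ [:: i; i] ++ b) -> False.
Proof.
move=> /reducedb_catr/reducedb_catl; rewrite /reducedb -[[:: i;
  i]]/([:: i] ++ [:: i]) cox_word_cat !cox_word1.
by rewrite cox_gen_sq => /eqP /= h; have := cox_length_le G [::]; rewrite {1}/cox_word big_nil h.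
Qed.

(** If one of the three vectors is the sum of the other two, the vector on which
the linear form [f] takes the value 1 is the sum of itself and a nonzero one. *)
Lemma triple_sum (a b c x y : V) (f : V -> R) : [set a; b; c] = [set x; y; x + y] ->
  (forall p q, f (p + q) = f p + f q) -> f a = 0 -> f b = 0 -> f c = 1 ->
  x != 0 -> y != 0 -> False.
Proof.
move=> TE fD fa fb fc x0 y0.
have onec z : [set a; b; c] z -> f z = 0 \/ z = c by move=> [[->|->]|->]; auto.
have xT : [set a; b; c] x by rewrite TE; left; left.
have yT : [set a; b; c] y by rewrite TE; left; right.
have xyT : [set a; b; c] (x + y) by rewrite TE; right.
have cT : [set x; y; x + y] c by rewrite -TE; right.
have := fD x y; case: (onec _ xyT) => [->|xyc].
  case: (onec _ xT) => [fx|->]; case: (onec _ yT) => [fy|->]; rewrite ?fx ?fy ?fc; try lra.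
  case: cT => [[cE|cE]|cE]; move: fc; rewrite cE ?fD ?fx ?fy; lra.
rewrite xyc fc; case: (onec _ xT) => [fx|xc]; case: (onec _ yT) => [fy|yc].
- by rewrite fx fy; lra.
- by move=> _; case/eqP: x0; apply: (addIr y); rewrite xyc add0r.
- by move=> _; case/eqP: y0; apply: (addrI x); rewrite xyc addr0.
by rewrite xc yc fc; lra.
Qed.

(** Consider three consecutive roots of a root sequence, with labels i, j, k.  If k
differs from i, then, up to the action of the group, their coefficients at the
simple root of k are 0, 0, 1, which [triple_sum] excludes.  If k = i and the
letters i, j commute, the word is not reduced. *)
Lemma contractibleP w T : contractible w T <->
  exists v, [/\ reducedb v, word (rev v) = w & braid_triple v T].
Proof.
split; last first.
  case=> v [rv vw [a [i [j [b [vE Gij TE]]]]]].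
  have rE : vroots v = vroots a ++ [:: wact a (al i); wact a (al i) + wact a (al j); wact a (al j)]
      ++ unzip2 (map (lact (a ++ [:: i; j; i])) (lroots b)).
    by rewrite /vroots vE; have [-> _] := lroots_braid a b Gij; rewrite /unzip2 !map_cat.
  split; last first.
    exists (rev v); first by apply/reducedE; rewrite reducedb_rev.
    by rewrite root_seqE revK rE; do 5!eexists; split; [reflexivity|].
  split.
    move=> r; rewrite TE -vw => Tr; apply: vroots_inversions => //; rewrite rE !mem_cat !inE.
    by case: Tr => [[->|->]|->]; rewrite eqxx ?orbT.
  exists (wact a (al i)), (wact a (al j)); rewrite TE.
  by apply/seteqP; split=> r [[->|->]|->]; rewrite /mkset /=; auto.
case=> -[Tinv [x [y TE]]] [u /reducedE[uw ru] [p [q [a [b [c [uE TE']]]]]]].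
pose v := rev u; have rv : reducedb v by rewrite reducedb_rev.
exists v; split=> //; first by rewrite revK.
rewrite root_seqE -/v in uE.
have sv : size v = (size p + (3 + size q))%N by rewrite -size_vroots uE !size_cat.
have [v1 [i [j [k [v2 [vE sp]]]]]] : exists v1 i j k v2,
    v = v1 ++ [:: i; j; k] ++ v2 /\ size v1 = size p.
  have sp : (size p <= size v)%N by lia.
  have := size_drop (size p) v; rewrite sv addKn.
  case D : (drop (size p) v) => [|i [|j [|k v2]]] // _.
  exists (take (size p) v), i, j, k, v2; rewrite size_takel //; split=> //.
  by rewrite /= -D cat_take_drop.
have abcE : [:: a; b; c] = map (wact v1) (vroots [:: i; j; k]).
  have := uE; rewrite vE !vroots_cat map_cat => /eqP; rewrite eqseq_cat ?size_vroots // => /andP[_].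
  by rewrite eqseq_cat // => /andP[/eqP<-].
have [aE bE cE] : [/\ a = wact v1 (al i), b = wact v1 (rf i (al j)) & c = wact v1 (rf i (rf j (al k)))].
  by move: abcE => /= -[-> -> ->].
have ij : i != j.
  apply/eqP=> ij; move: rv; rewrite vE ij.
  by rewrite -[[:: j; j; k] ++ v2]/([:: j; j] ++ (k :: v2)) => /reducedb_nosq.
have jk : j != k.
  apply/eqP=> jk; move: rv; rewrite vE jk.
  by rewrite -[[:: i; k; k] ++ v2]/([:: i] ++ ([:: k; k] ++ v2)) catA => /reducedb_nosq.
have kin (r : V) : T r -> r != 0.
  rewrite TE' => Tr; apply: (@vroots_neq0 v); rewrite uE !mem_cat !inE.
  by case: Tr => [[->|->]|->]; rewrite eqxx ?orbT.
(* the linear form is the coefficient at alpha_k, transported by the prefix v1 *)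
have [ki|ki] := eqVneq k i; last first.
  case: (@triple_sum a b c x y (fun r => wact (rev v1) r 0 k)).
  - by rewrite -TE' TE.
  - by move=> ? ?; rewrite word_actD mxE.
  - by rewrite aE word_actKrev /simple_root mxE (negPf ki).
  - by rewrite bE word_actKrev refl_coord // /simple_root mxE [k == j]eq_sym (negPf jk).
  - by rewrite cE word_actKrev !refl_coord // 1?eq_sym // /simple_root mxE !eqxx.
  - by apply: kin; rewrite TE; left; left.
  by apply: kin; rewrite TE; left; right.
have [Gij|nGij] := boolP (G i j); last first.
  have : reducedb (v1 ++ [:: i; j; i] ++ v2) by move: rv; rewrite vE ki.
  have br : braid_eq G (v1 ++ [:: i; j; i] ++ v2) ((v1 ++ [:: j]) ++ [:: i; i] ++ v2).
    by rewrite -catA; exact: braid_move_braid_eq (braid_move_comm v1 (i :: v2) ij nGij).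
  rewrite /reducedb (cox_word_braid_eq br) => /eqP h.
  have : reducedb ((v1 ++ [:: j]) ++ [:: i; i] ++ v2).
    by rewrite /reducedb h !size_cat /=; apply/eqP; lia.
  by move=> /reducedb_nosq.
exists v1, i, j, v2; split=> //; first by rewrite vE ki.
rewrite TE' aE bE cE ki refl_adj // (@refl_adj R n G j i) 1?adj_sym //.
have := refl_linear G i 1 (al i) (al j); rewrite !scale1r => ->.
by rewrite refl_self refl_adj // addrCA addNr addr0 word_actD [wact v1 (al j) + _]addrC.
Qed.
End RootSequences.

(** * Good words represent content maximal elements *)

Lemma sum_count_mem n (v : seq 'I_n) : (\sum_(i < n) count_mem i v)%N = size v.
Proof.
elim: v => [|x v IH]; first by rewrite big1.
rewrite /= -IH big_split /= (bigD1 x) //= eqxx big1 => [|i /negPf ix]; first by rewrite addn0.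
by rewrite eq_sym ix.
Qed.

Lemma card_fset_set_seq (T : choiceType) (A : set T) (s : seq T) :
  uniq s -> (forall x, A x <-> x \in s) -> #|` fset_set A|%fset = size s.
Proof.
move=> us As; have -> : A = [set` [fset x in s]%fset].
  by apply/seteqP; split=> x /=; rewrite in_fset As.
by rewrite set_fsetK card_fseq undup_id.
Qed.

Section GoodIsContentMaximal.
Variables (R : realType) (n : nat) (G : coxgraph n).
Local Notation W := (coxgroup G).
Local Notation V := 'rV[R]_n.
Local Notation s := (cox_gen G).
Local Notation word := (cox_word G).
Local Notation len := (@cox_length n G).
Local Notation al := (@simple_root R n).
Local Notation wact := (@word_act R n G).
Local Notation reducedb := (@reducedb n G).
Local Notation lroots := (@lroots R n G).
Local Notation vroots := (@vroots R n G).
Local Notation braid_move := (braid_move G).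
Local Notation braid_eq := (braid_eq G).
Local Notation good := (good G).
Local Notation matched := (matched G).
Local Notation symG := (@adj_sym n G).
Local Notation irrG := (@adj_irr n G).
Implicit Types (i j k : 'I_n) (u v a b : seq 'I_n) (w : W) (r : V).

Lemma braid_eq_size u v : braid_eq u v -> size u = size v.
Proof. by elim=> // x y _ -> [] *; rewrite !size_cat. Qed.

Lemma reducedb_braid_eq u v : reducedb u -> braid_eq u v -> reducedb v.
Proof. by rewrite /reducedb => /eqP ru uv;
  rewrite -(cox_word_braid_eq uv) -(braid_eq_size uv) ru. Qed.

Lemma good_reducedb v : good v -> reducedb v.
Proof.
move=> gv; apply/negPn/negP => /(nonreduced_braid_eq R)[a [i [b vb]]].
by have [gb _] := good_braid_eq symG irrG gv vb; have := good_no_square symG irrG gb.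
Qed.

(** Elements are represented by reversed words, to fit [lroots]. *)
Lemma reducedb_class_braid_eq u v w : reducedb u -> reducedb v -> word (rev u) = w ->
  word (rev v) = w -> braid_eq u v.
Proof.
move=> ru rv uw vw; apply: (matsumoto R) => //; apply: (can_inj (@invgK _)).
by rewrite -!cox_word_rev uw vw.
Qed.

Definition block v i j : set V := [set r | exists2 k, (k, r) \in lroots v & k \in [:: i; j]].

Lemma blockC v i j : block v i j = block v j i.
Proof. by apply/seteqP; split=> r [k kr]; rewrite !inE orbC; exists k; rewrite ?inE. Qed.

(** A braid move on a matched pair permutes the roots of that pair and leaves
those of the other pairs alone, because matched pairs are disjoint. *)
Lemma block_step_sub v v' i j : good v -> braid_move v v' -> matched v i j ->
  block v i j `<=` block v' i j.
Proof.
move=> gv vv' Mij r [k]; case: vv' gv Mij => [a b x y xy nxy _ _|a b x y Gxy gv Mij].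
  have [A [B [r1 [r2 [-> E]]]]] := lroots_comm R a b xy nxy => kr kij; exists k => //.
  by rewrite E; move: kr; rewrite !mem_cat !inE; case: (_ \in A); case: (_ == (x, _));
    case: (_ == (y, _)).
have [-> E] := lroots_braid R a b Gxy => kr kij.
have Mxy : matched (a ++ [:: x; y; x] ++ b) x y.
  by rewrite /matched Gxy (@subseq3_cat _ x y x a [::] [::] b).
have [uniqM _ _] := gv.
have Myx : matched (a ++ [:: x; y; x] ++ b) y x by rewrite (matchedC symG).
have Mji : matched (a ++ [:: x; y; x] ++ b) j i by rewrite (matchedC symG).
have xyij : (x \in [:: i; j]) = (y \in [:: i; j]).
  rewrite !inE; apply/orP/orP => -[]/eqP E'; rewrite -?E' in Mij Mji.
  - by right; apply/eqP; apply: (uniqM x).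
  - by left; apply/eqP; apply: (uniqM x).
  - by right; apply/eqP; apply: (uniqM y).
  - by left; apply/eqP; apply: (uniqM y).
move: kr; rewrite !mem_cat => /or3P[kA|ktri|kB].
- by exists k => //; rewrite E !mem_cat kA.
- suff [k' k'in k'xy] : exists2 k', (k', r) \in lroots (a ++ [:: y; x; y] ++ b) & k' \in [:: x; y].
    exists k' => //; have kxy : (k == x) || (k == y).
      by move: ktri; rewrite !inE => /or3P[]/eqP[-> _]; rewrite eqxx ?orbT.
    have xij : x \in [:: i; j] by case/orP: kxy => /eqP kE; [|rewrite xyij]; rewrite -kE.
    by move: k'xy; rewrite [k' \in [:: x; y]]inE mem_seq1 => /orP[]/eqP->; rewrite -?xyij.
  by move: ktri; rewrite E; rewrite !inE => /or3P[]/eqP[_ ->];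
    [exists y|exists x|exists y]; rewrite ?mem_cat ?inE ?eqxx ?orbT.
by exists k => //; rewrite E !mem_cat kB !orbT.
Qed.

Lemma block_step v v' i j : good v -> braid_move v v' -> matched v i j ->
  block v i j = block v' i j.
Proof.
move=> gv vv' Mij; apply/seteqP; split; first exact: block_step_sub.
apply: block_step_sub; [exact: (good_step symG irrG gv vv')|exact: (braid_move_sym symG vv')|].
by rewrite (matched_step symG irrG i j gv vv').
Qed.

Lemma block_braid_eq v v' i j : good v -> braid_eq v v' -> matched v i j ->
  block v i j = block v' i j.
Proof.
move=> gv vv' Mij; elim: vv' => // x y vx -> xy.
have [gx Mx] := good_braid_eq symG irrG gv vx.
by apply: block_step; rewrite ?Mx.
Qed.

Lemma block_triple a b i j : G i j -> i \notin a -> j \notin a -> i \notin b -> j \notin b ->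
  block (a ++ [:: i; j; i] ++ b) i j =
  [set wact a (al i); wact a (al i) + wact a (al j); wact a (al j)].
Proof.
move=> Gij ia ja ib jb; have [E _] := lroots_braid R a b Gij; apply/seteqP; split=> r.
  case=> k; rewrite E !mem_cat => /or3P[/lroots_mem ka|ktri|/mapP[[k' r'] /lroots_mem k'b [-> _]]].
  - by rewrite !inE => /orP[]/eqP kE; rewrite -kE ka in ia ja.
  - by move=> _; move: ktri; rewrite !inE => /or3P[]/eqP[_ ->]; rewrite /mkset /=; auto.
  by rewrite !inE => /orP[]/eqP kE; rewrite -kE k'b in ib jb.
by case=> [[->|->]|->]; [exists i|exists j|exists i];
  rewrite ?E ?mem_cat ?inE ?eqxx ?orbT.
Qed.

Lemma good_triple_block v T : good v -> braid_triple G v T ->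
  exists i j, matched v i j /\ T = block v i j.
Proof.
move=> gv [a [i [j [b [vE Gij TE]]]]]; exists i, j.
rewrite vE in gv *; have [ia ib ja jb] := good_braid_notin irrG Gij gv.
by rewrite block_triple // /matched Gij (@subseq3_cat _ i j i a [::] [::] b).
Qed.

(** A contractible triple shows up as a braid factor in some reduced word of the
element; that word is good, so the factor is a matched pair.  Conversely, the
letters of a matched pair can be gathered by [braid_eq_gather]. *)
Lemma contractible_good v w T : good v -> word (rev v) = w ->
  contractible w T <-> exists i j, matched v i j /\ T = block v i j.
Proof.
move=> gv vw; have rv := good_reducedb gv; split.
  move=> /contractibleP[v' [rv' v'w bT]]; have vv' := reducedb_class_braid_eq rv rv' vw v'w.
  have [gv' Mv'] := good_braid_eq symG irrG gv vv'.
  have [i [j [Mij ->]]] := good_triple_block gv' bT; rewrite Mv' in Mij.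
  by exists i, j; split=> //; rewrite (block_braid_eq gv vv').
(* by symmetry, i is the letter that occurs twice *)
case=> i [j [Mij ->]]; wlog ci : i j Mij / count_mem i v = 2%N.
  move=> H; case: (matched_count symG irrG gv Mij) => -[ci cj]; first exact: H.
  by rewrite blockC; apply: H; rewrite // (matchedC symG).
have [Gij _] := andP Mij; have sub := matched_aba symG irrG gv Mij ci.
have [a [b [c [d vE]]]] := subseq3_split sub.
have [cb cc] := good_aba_commutes irrG gv Gij vE.
have vv' : braid_eq v ((a ++ b) ++ [:: i; j; i] ++ (c ++ d)) by rewrite vE;
  apply: (braid_eq_gather symG).
have [gv' _] := good_braid_eq symG irrG gv vv'.
have [ia ib ja jb] := good_braid_notin irrG Gij gv'.
apply/contractibleP; exists ((a ++ b) ++ [:: i; j; i] ++ (c ++ d)); split.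
- exact: good_reducedb.
- by rewrite -vw !cox_word_rev (cox_word_braid_eq vv').
exists (a ++ b), i, j, (c ++ d); split=> //.
by rewrite (block_braid_eq gv vv' Mij) block_triple.
Qed.

Lemma cox_supp_reducedb v w : reducedb v -> word (rev v) = w -> cox_supp w = [set i | i \in v]%SET.
Proof.
move=> rv vw; apply/setP => i; rewrite !inE; apply/asboolP/idP.
  case=> u /reducedE[uw ru] iu.
  have uv : braid_eq (rev u) v by apply: reducedb_class_braid_eq vw; rewrite ?reducedb_rev ?revK.
  by rewrite -(braid_eq_mem uv) mem_rev.
move=> iv; exists (rev v); last by rewrite mem_rev.
by apply/reducedE; rewrite reducedb_rev.
Qed.

Lemma cox_length_reducedb v w : reducedb v -> word (rev v) = w -> len w = size v.
Proof. by rewrite -reducedb_rev => /eqP rv <-; rewrite rv size_rev. Qed.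

Lemma good_freely_braided v w : good v -> word (rev v) = w -> @freely_braided R n G w.
Proof.
move=> gv vw; have rv := good_reducedb gv; have [uniqM _ _] := gv.
move=> T1 T2 /(contractible_good _ gv vw)[i [j [Mij ->]]] /(contractible_good _ gv vw)[i' [j' [Mij' ->]]].
case=> r [[k kr kij] [k' kr' kij']]; rewrite -(lroots_fun rv kr kr') in kij'.
have Mji : matched v j i by rewrite (matchedC symG).
have Mji' : matched v j' i' by rewrite (matchedC symG).
move: kij kij'; rewrite !inE => /orP[]/eqP kE /orP[]/eqP kE';
  rewrite -?kE -?kE' in Mij Mji Mij' Mji' *.
- by rewrite (uniqM _ _ _ Mij Mij').
- by rewrite (uniqM _ _ _ Mij Mji') blockC.
- by rewrite (uniqM _ _ _ Mji Mij') blockC.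
- by rewrite (uniqM _ _ _ Mji Mji') blockC.
Qed.

(** In each matched pair exactly one letter occurs twice. *)
Lemma ncontractible_good v w : good v -> word (rev v) = w ->
  @ncontractible R n G w = #|[set i | count_mem i v == 2%N]%SET|.
Proof.
move=> gv vw; have rv := good_reducedb gv; have [uniqM _ _] := gv.
set D := [set i | _]%SET; pose p i := odflt i [pick j | matched v i j].
have pM i : i \in D -> matched v i (p i).
  rewrite inE => /eqP ci; rewrite /p; case: pickP => //= nM.
  by case: (good_matched_or i gv) => [[j]|[]]; rewrite ?nM ?ci.
rewrite cardE -(size_map (fun i => block v i (p i))); apply: card_fset_set_seq.
  rewrite map_inj_in_uniq ?enum_uniq // => i i'; rewrite !mem_enum => iD i'D bE.
  have iv : i \in v by rewrite -has_pred1 has_count; move: iD; rewrite inE => /eqP->.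
  have [r ir] := mem_lroots R G iv.
  have : block v i (p i) r by exists i; rewrite ?inE ?eqxx.
  rewrite bE => -[k kr]; rewrite -(lroots_fun rv ir kr) !inE => /orP[/eqP//|/eqP iE].
  case: (matched_count symG irrG gv (pM _ i'D)) => -[c1 c2].
    by move: iD; rewrite inE iE c2.
  by move: i'D; rewrite inE c1.
move=> T; split.
  move=> /(contractible_good _ gv vw)[i [j [Mij ->]]].
  wlog ci : i j Mij / count_mem i v = 2%N.
    move=> H; case: (matched_count symG irrG gv Mij) => -[ci cj]; first exact: H.
    by rewrite blockC; apply: H; rewrite // (matchedC symG).
  have iD : i \in D by rewrite inE ci.
  by apply/mapP; exists i; rewrite ?mem_enum // (uniqM _ _ _ Mij (pM _ iD)).
case/mapP=> i; rewrite mem_enum => iD ->; apply/(contractible_good _ gv vw).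
by exists i, (p i); split=> //; apply: pM.
Qed.

(** The number of occurrences of a letter is 0, 1 or 2, and the letters
occurring twice account for the difference between length and support. *)
Theorem good_content_maximal v w : good v -> word (rev v) = w -> content_maximal R w.
Proof.
move=> gv vw; have rv := good_reducedb gv; split; first exact: good_freely_braided vw.
rewrite (cox_supp_reducedb rv vw) (cox_length_reducedb rv vw) (ncontractible_good gv vw).
apply/eqP; rewrite eq_sym subr_eq eqz_nat; apply/eqP.
rewrite -sum_count_mem -!sum1_card [X in (X + _)%N]big_mkcond [X in (_ + X)%N]big_mkcond -big_split /=.
apply: eq_bigr => i _ /=; rewrite !inE -has_pred1 has_count.
by have := good_count_le2 symG irrG i gv; case: (count_mem i v) => [|[|[|]]].
Qed.
End GoodIsContentMaximal.

(** * Content maximal elements have good words *)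

Section Index.
Local Open Scope nat_scope.
Variable T : eqType.
Implicit Types (x y : T) (A B C : seq T).

Lemma index_mid A C B x : x \in C -> x \notin A -> index x (A ++ C ++ B) = size A + index x C.
Proof. by move=> xC /negPf xA; rewrite !index_cat xA xC. Qed.

Lemma index_mid_bound A C B x : uniq (A ++ C ++ B) -> x \in C ->
  size A <= index x (A ++ C ++ B) < size A + size C.
Proof.
move=> u xC; have xA : x \notin A.
  by move: u; rewrite cat_uniq => /and3P[_ /hasPn/(_ x) + _]; rewrite mem_cat xC => /(_ isT).
by rewrite index_mid // leq_addr ltn_add2l index_mem.
Qed.

Lemma index_out A C C' B x : x \notin C -> x \notin C' -> size C = size C' ->
  index x (A ++ C' ++ B) = index x (A ++ C ++ B) /\
  (index x (A ++ C ++ B) < size A \/ size A + size C <= index x (A ++ C ++ B)).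
Proof.
move=> /negPf xC /negPf xC' sC; rewrite !index_cat xC xC' sC; case: ifP => [xA|_].
  by split=> //; left; rewrite index_mem.
by split=> //; right; lia.
Qed.

Lemma index_order A C C' B x y : uniq (A ++ C ++ B) -> uniq (A ++ C' ++ B) -> C =i C' ->
  size C = size C' -> ~~ ((x \in C) && (y \in C)) ->
  index x (A ++ C ++ B) < index y (A ++ C ++ B) ->
  index x (A ++ C' ++ B) < index y (A ++ C' ++ B).
Proof.
move=> u u' CC' sC; have [xC|xC] := boolP (x \in C); have [yC|yC] //= := boolP (y \in C) => _.
- have := index_mid_bound u xC; rewrite CC' in xC; have := index_mid_bound u' xC.
  have yC' : y \notin C' by rewrite -CC'.
  by have [->] := index_out A B yC yC' sC; lia.
- have := index_mid_bound u yC; rewrite CC' in yC; have := index_mid_bound u' yC.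
  have xC' : x \notin C' by rewrite -CC'.
  by have [->] := index_out A B xC xC' sC; lia.
have yC' : y \notin C' by rewrite -CC'.
have xC' : x \notin C' by rewrite -CC'.
by have [-> _] := index_out A B xC xC' sC; have [-> _] := index_out A B yC yC' sC.
Qed.

Lemma subseq_drop3 (x0 : T) (v : seq T) k1 k2 k3 : k1 < k2 -> k2 < k3 -> k3 < size v ->
  subseq [:: nth x0 v k1; nth x0 v k2; nth x0 v k3] v.
Proof.
have stp s k m : m <= k -> k < size v -> subseq s (drop k.+1 v) ->
    subseq (nth x0 v k :: s) (drop m v).
  move=> mk kv su; rewrite -(cat_take_drop (k - m) (drop m v)) drop_drop subnK // [drop k v](drop_nth x0) //.
  rewrite -[_ :: s]cat0s; apply: cat_subseq; first exact: sub0seq.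
  by rewrite [subseq _ _]/= eqxx.
move=> h1 h2 h3; rewrite -[v in X in subseq _ X]drop0.
do 3!(apply: (@stp _ _ _); [lia|lia|]); exact: sub0seq.
Qed.

Lemma uniq_map_inj (U : eqType) (f : T -> U) (s : seq T) : uniq (map f s) ->
  {in s &, injective f}.
Proof.
elim: s => // z s IH /= /andP[fz us] x y; rewrite !inE => /orP[/eqP->|xs] /orP[/eqP->|ys] // fE.
- by case/negP: fz; rewrite fE map_f.
- by case/negP: fz; rewrite -fE map_f.
exact: IH.
Qed.
End Index.

Section ContentMaximalIsGood.
Variables (R : realType) (n : nat) (G : coxgraph n).
Local Notation W := (coxgroup G).
Local Notation V := 'rV[R]_n.
Local Notation word := (cox_word G).
Local Notation len := (@cox_length n G).
Local Notation al := (@simple_root R n).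
Local Notation wact := (@word_act R n G).
Local Notation reducedb := (@reducedb n G).
Local Notation lroots := (@lroots R n G).
Local Notation vroots := (@vroots R n G).
Local Notation braid_move := (braid_move G).
Local Notation braid_eq := (braid_eq G).
Local Notation good := (good G).
Local Notation matched := (matched G).
Local Notation symG := (@adj_sym n G).
Local Notation irrG := (@adj_irr n G).
Implicit Types (i j k : 'I_n) (u v : seq 'I_n) (w : W) (a b c r : V) (T : set V).

(** The trace of a contractible triple in a reduced word where its
roots need not be consecutive: the labels are still i, j, i, and no other
neighbour of [i] has a root between the two outer ones. *)
Definition split_triple v T i j a b c : Prop :=
  [/\ G i j /\ T = [set a; b; c],
      [/\ (i, a) \in lroots v, (j, b) \in lroots v & (i, c) \in lroots v],
      (index a (vroots v) < index b (vroots v) < index c (vroots v))%N &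
      forall k r, (k, r) \in lroots v -> G i k -> r != b ->
        (index r (vroots v) < index a (vroots v))%N \/ (index c (vroots v) < index r (vroots v))%N].

Lemma braid_split_triple v T : reducedb v -> braid_triple G v T ->
  exists i j a b c, split_triple v T i j a b c.
Proof.
move=> rv [p [i [j [q [vE Gij TE]]]]]; have [lE _] := lroots_braid R p q Gij.
set a := wact p (al i) in TE lE *; set c := wact p (al j) in TE lE *.
set B := map _ _ in lE; exists i, j, a, (a + c), c.
have rE : vroots v = vroots p ++ [:: a; a + c;
  c] ++ unzip2 B by rewrite /vroots vE lE /unzip2 !map_cat.
have ur := uniq_vroots R rv; rewrite rE in ur.
have [aA bA cA] : [/\ a \notin vroots p, a + c \notin vroots p & c \notin vroots p].
  have := ur; rewrite cat_uniq => /and3P[_ /hasPn h _].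
  by split; apply: h; rewrite mem_cat !inE eqxx ?orbT.
have [ab ac bc] : [/\ a != a + c, a != c & a + c != c].
  have := ur; rewrite !cat_uniq => /and3P[_ _ /and3P[+ _ _]].
  by rewrite /= !inE !negb_or !andbT => /andP[/andP[-> ->] ->].
have [ia ib ic] : [/\ index a (vroots v) = size (vroots p), index (a + c) (vroots v) = (size (vroots p)).+1
    & index c (vroots v) = (size (vroots p)).+2].
  rewrite rE !index_mid ?inE ?eqxx ?orbT //= eqxx (negPf ab) (negPf ac) (negPf bc) !eqxx.
  by rewrite addn0 addn1 addn2.
have [la lb lc] : [/\ (i, a) \in lroots v, (j, a + c) \in lroots v & (i, c) \in lroots v].
  by rewrite vE lE !mem_cat !inE !eqxx ?orbT.
split; [by split|by split|by rewrite ia ib ic !ltnSn|].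
move=> k r kr Gik rb.
have ki : k != i by apply: contraTneq Gik => ->; rewrite adj_irr.
have rout : r \notin [:: a; a + c; c].
  apply/negP; rewrite !inE (negPf rb) /= => /orP[]/eqP rE'; rewrite rE' in kr.
    by case/eqP: ki; apply: lroots_fun rv kr la.
  by case/eqP: ki; apply: lroots_fun rv kr lc.
have [_] := @index_out _ (vroots p) _ _ (unzip2 B) _ rout rout erefl.
by rewrite -rE ia ic /= addn3.
Qed.

(** A commutation cannot exchange two roots with adjacent labels, and the
conditions in [split_triple] compare only such roots. *)
Lemma split_triple_comm v v' T i j a b c A B x y p q : reducedb v -> reducedb v' -> ~~ G x y ->
  lroots v = A ++ [:: (x, p); (y, q)] ++ B -> lroots v' = A ++ [:: (y, q); (x, p)] ++ B ->
  split_triple v T i j a b c -> split_triple v' T i j a b c.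
Proof.
move=> rv rv' nxy lE lE' [[Gij TE] [la lb lc] /andP[ab bc] out].
have lmem e : (e \in lroots v') = (e \in lroots v).
  by rewrite lE lE' !mem_cat !inE; case: (e == (x, p)); case: (e == (y, q)); rewrite ?orbT.
have rE : vroots v = unzip2 A ++ [:: p; q] ++ unzip2 B by rewrite /vroots lE /unzip2 !map_cat.
have rE' : vroots v' = unzip2 A ++ [:: q; p] ++ unzip2 B by rewrite /vroots lE' /unzip2 !map_cat.
have ur := uniq_vroots R rv; have ur' := uniq_vroots R rv'.
have lp : (x, p) \in lroots v by rewrite lE !mem_cat !inE eqxx !orbT.
have lq : (y, q) \in lroots v by rewrite lE !mem_cat !inE eqxx !orbT.
have keep k l r t : (k, r) \in lroots v -> (l, t) \in lroots v -> G k l ->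
    (index r (vroots v) < index t (vroots v))%N -> (index r (vroots v') < index t (vroots v'))%N.
  move=> kr lt Gkl; rewrite rE rE'; apply: index_order; rewrite -?rE -?rE' //.
    by move=> z; rewrite !inE orbC.
  apply/negP=> /andP[]; rewrite !inE => rpq tpq.
  case/orP: rpq tpq => /eqP rE0; rewrite rE0 in kr; case/orP=> /eqP tE0; rewrite tE0 in lt.
  - by rewrite (lroots_fun rv kr lp) (lroots_fun rv lt lp) adj_irr in Gkl.
  - by rewrite (lroots_fun rv kr lp) (lroots_fun rv lt lq) (negPf nxy) in Gkl.
  - by rewrite (lroots_fun rv kr lq) (lroots_fun rv lt lp) adj_sym (negPf nxy) in Gkl.
  by rewrite (lroots_fun rv kr lq) (lroots_fun rv lt lq) adj_irr in Gkl.
split; rewrite ?lmem //.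
  by rewrite (keep i j) // (keep j i) // adj_sym.
move=> k r; rewrite lmem => kr Gik rb; case: (out k r kr Gik rb) => [ra|cr].
  by left; apply: (keep k i); rewrite // adj_sym.
by right; apply: (keep i k).
Qed.

(** The labels of the three roots of a disjoint braid factor change,
but both letters were already present at that place before the move. *)
Lemma split_triple_braid v v' T i j a b c A B x y p q r0 : reducedb v -> reducedb v' ->
  lroots v = A ++ [:: (x, p); (y, q); (x, r0)] ++ B ->
  lroots v' = A ++ [:: (y, r0); (x, q); (y, p)] ++ B ->
  a \notin [:: p; q; r0] -> b \notin [:: p; q; r0] -> c \notin [:: p; q; r0] ->
  split_triple v T i j a b c -> split_triple v' T i j a b c.
Proof.
move=> rv rv' lE lE' aC bC cC [[Gij TE] [la lb lc] /andP[ab bc] out].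
have rE : vroots v = unzip2 A ++ [:: p; q; r0] ++ unzip2 B by rewrite /vroots lE /unzip2 !map_cat.
have rE' : vroots v' = unzip2 A ++ [:: r0; q;
  p] ++ unzip2 B by rewrite /vroots lE' /unzip2 !map_cat.
have ur := uniq_vroots R rv; have ur' := uniq_vroots R rv'.
have CC' : [:: p; q; r0] =i [:: r0; q; p].
  by move=> z; rewrite !inE; case: (z == p); case: (z == q); case: (z == r0).
have keep r t : ~~ ((r \in [:: p; q; r0]) && (t \in [:: p; q; r0])) ->
    (index r (vroots v) < index t (vroots v))%N -> (index r (vroots v') < index t (vroots v'))%N.
  by move=> rt; rewrite rE rE'; apply: index_order; rewrite -?rE -?rE'.
have lkeep k r : r \notin [:: p; q; r0] -> ((k, r) \in lroots v') = ((k, r) \in lroots v).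
  rewrite lE lE' !mem_cat !inE !negb_or => /and3P[/negPf rp /negPf rq /negPf rr].
  by rewrite !xpair_eqE rp rq rr !andbF.
split; rewrite ?lkeep //.
  by rewrite !keep // ?(negPf aC) ?(negPf bC) ?(negPf cC) ?andbF.
move=> k r kr Gik rb; have [rC|rC] := boolP (r \in [:: p; q; r0]); last first.
  rewrite lkeep // in kr.
  by case: (out k r kr Gik rb) => h; [left|right]; apply: keep h; rewrite (negPf rC) ?andbF.
(* a root of the factor that carried the letter k before the move *)
have [r' r'C kr'] : exists2 r', r' \in [:: p; q; r0] & (k, r') \in lroots v.
  have : k = x \/ k = y.
    have : r \in vroots v' by apply: lroots_vroots kr.
    have lx : (x, q) \in lroots v' by rewrite lE' !mem_cat !inE eqxx !orbT.
    have ly1 : (y, r0) \in lroots v' by rewrite lE' !mem_cat !inE eqxx !orbT.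
    have ly2 : (y, p) \in lroots v' by rewrite lE' !mem_cat !inE eqxx !orbT.
    move=> _; move: rC; rewrite !inE => /or3P[]/eqP rE0; rewrite rE0 in kr.
    - by right; apply: lroots_fun rv' kr ly2.
    - by left; apply: lroots_fun rv' kr lx.
    by right; apply: lroots_fun rv' kr ly1.
  case=> ->; first by exists p; rewrite ?lE ?mem_cat !inE ?eqxx ?orbT.
  by exists q; rewrite ?lE ?mem_cat !inE ?eqxx ?orbT.
have r'b : r' != b by apply: contraNneq bC => <-.
have := out k r' kr' Gik r'b.
have := @index_mid_bound _ (unzip2 A) [:: p; q; r0] (unzip2 B) r'.
rewrite -rE => /(_ ur r'C) hr'.
have := @index_mid_bound _ (unzip2 A) [:: r0; q; p] (unzip2 B) r.
rewrite -rE' -CC' => /(_ ur' rC) hr.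
have := @index_out _ (unzip2 A) [:: p; q; r0] [:: r0; q; p] (unzip2 B) a aC.
rewrite -CC' -rE -rE' => /(_ aC erefl)[-> ha].
have := @index_out _ (unzip2 A) [:: p; q; r0] [:: r0; q; p] (unzip2 B) c cC.
rewrite -CC' -rE -rE' => /(_ cC erefl)[-> hc].
by move: hr' hr ha hc; rewrite /=; clear; lia.
Qed.

(** In a freely braided element the triple of a braid move is either [T] itself or
disjoint from [T]. *)
Lemma split_triple_step w v v' T : freely_braided R w -> contractible w T ->
  reducedb v -> word (rev v) = w -> braid_move v v' ->
  (exists i j a b c, split_triple v T i j a b c) ->
  exists i j a b c, split_triple v' T i j a b c.
Proof.
move=> fb cT rv vw vv'; have rv' : reducedb v' := reducedb_braid_eq rv (braid_move_braid_eq vv').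
case: vv' rv rv' vw => [p q x y xy nxy|p q x y Gxy] rv rv' vw [i [j [a [b [c sT]]]]].
  have [A [B [r [t [lE lE']]]]] := lroots_comm R p q xy nxy.
  by exists i, j, a, b, c; apply: split_triple_comm lE lE' sT.
have [lE lE'] := lroots_braid R p q Gxy.
set r := wact p (al x) in lE lE'; set t := wact p (al y) in lE lE'.
pose T' := [set r; r + t; t].
have cT' : contractible w T'.
  by apply/contractibleP; exists (p ++ [:: x; y; x] ++ q); split=> //; exists p, x, y, q.
have [TT'|disj] := pselect (T `&` T' !=set0).
  rewrite (fb _ _ cT cT' TT'); apply: braid_split_triple => //.
  exists p, y, x, q; split; rewrite 1?adj_sym //.
  by rewrite /T' -/r -/t [t + r]addrC; apply/seteqP; split=> z [[->|->]|->]; rewrite /mkset /=;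
    auto.
exists i, j, a, b, c; have [[_ TE] _ _ _] := sT.
have out z : T z -> z \notin [:: r; r + t; t].
  move=> Tz; apply/negP=> zC; apply: disj; exists z; split=> //.
  by move: zC; rewrite !inE => /or3P[]/eqP->; rewrite /T' /mkset /=; auto.
apply: split_triple_braid lE lE' _ _ _ sT => //; apply: out; rewrite TE /mkset /=; auto.
Qed.

Lemma split_triple_exists w v T : freely_braided R w -> contractible w T ->
  reducedb v -> word (rev v) = w -> exists i j a b c, split_triple v T i j a b c.
Proof.
move=> fb cT rv vw; have /contractibleP[v1 [rv1 v1w bT]] := cT.
have [_ []//] : reducedb v /\ (word (rev v) = w /\ exists i j a b c, split_triple v T i j a b c).
elim: (reducedb_class_braid_eq R rv1 rv v1w vw) => [|x y _ [rx [xw sx]] xy].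
  by split=> //; split=> //; apply: braid_split_triple.
split; first exact: reducedb_braid_eq rx (braid_move_braid_eq xy).
split; first by rewrite cox_word_rev -(cox_word_braid_eq (braid_move_braid_eq xy)) -cox_word_rev.
exact: split_triple_step xw xy sx.
Qed.

Section Final.
Variables (w : W) (v : seq 'I_n).
Hypotheses (cmw : content_maximal R w) (rv : reducedb v) (vw : word (rev v) = w).

Let fb : freely_braided R w. Proof. by case: cmw. Qed.

Let CT : set (set V) := [set T | contractible w T].

Lemma contractible_finite : finite_set CT.
Proof.
pose L := [seq [set e.1.1; e.1.2;
  e.2] | e <- allpairs pair (allpairs pair (vroots v) (vroots v)) (vroots v)].
apply: (@sub_finite_set _ _ [set` L]); last exact: finite_seq.
move=> T cT; have [i [j [a [b [c [[_ TE] [la lb lc] _ _]]]]]] := split_triple_exists fb cT rv vw.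
apply/mapP; exists (a, b, c) => //; apply/allpairsP; exists ((a, b), c); split=> //=.
  by apply/allpairsP; exists (a, b); split=> //=; apply: lroots_vroots; eassumption.
exact: lroots_vroots lc.
Qed.

Lemma contractible_eq T1 T2 r : CT T1 -> CT T2 -> T1 r -> T2 r -> T1 = T2.
Proof. by move=> c1 c2 r1 r2; apply: fb => //; exists r. Qed.

(** A count.  Let [f T] be the last root of the triple [T], which
carries the same letter as its first root.  Erasing these N(w) roots keeps the
support, so if the support has l(w) - N(w) elements, the remaining letters
are distinct.  Two equal letters are thus either the outer letters of one
triple or would produce two equal remaining letters. *)
Lemma same_letter_contractible k r r' : (k, r) \in lroots v -> (k, r') \in lroots v -> r != r' ->
  exists T, [/\ CT T, T r & T r'].
Proof.
have /choice[f fP] : forall T, exists c, CT T -> exists i j a b, split_triple v T i j a b c.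
  move=> T; have [cT|ncT] := pselect (CT T); last by exists 0.
  by have [i [j [a [b [c sT]]]]] := split_triple_exists fb cT rv vw; exists c => _;
    exists i, j, a, b.
have fT T : CT T -> T (f T) by move=> /fP[i [j [a [b [[_ TE] _ _ _]]]]]; rewrite [X in X _]TE;
  right.
have inTs T : T \in fset_set CT <-> CT T.
  by rewrite in_fset_set; [split; rewrite in_setE|apply: contractible_finite].
pose D := [seq f T | T <- fset_set CT].
have DP r0 : r0 \in D -> exists2 T, CT T & r0 = f T.
  by case/mapP=> T /inTs cT ->; exists T.
have inD T : CT T -> f T \in D by move=> cT; apply/mapP; exists T => //; apply/inTs.
have uD : uniq D.
  rewrite map_inj_in_uniq ?fset_uniq // => T1 T2 /inTs c1 /inTs c2 fE.
  by apply: (contractible_eq c1 c2 (fT _ c1)); rewrite fE; apply: fT.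
have sD : size D = ncontractible R w by rewrite size_map.
(* the labelled roots that remain *)
pose F := [seq e <- lroots v | e.2 \notin D].
have sF : (size F + size D = size v)%N.
  have -> : size D = count (mem D) (vroots v).
    rewrite -size_filter; apply/perm_size/uniq_perm => //; first exact/filter_uniq/uniq_vroots.
    move=> r0; rewrite mem_filter -[mem D r0]/(r0 \in D).
    have [/DP[T cT ->]|//] := boolP (r0 \in D).
    by have [i [j [a [b [_ [_ _ /lroots_vroots->]]]]]] := fP T cT.
  by rewrite /F size_filter /vroots /unzip2 count_map addnC -[RHS](size_lroots R G) -(count_predC (fun e => e.2 \in D)).
have keptP T : CT T -> exists i j a b, split_triple v T i j a b (f T) /\ (i, a) \in F.
  move=> cT; have [i [j [a [b sT]]]] := fP T cT; exists i, j, a, b; split=> //.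
  have [[_ TE] [la _ _] /andP[ab bc] _] := sT; rewrite mem_filter la andbT /=.
  apply/negP=> /DP[T' cT' aE].
  have TT' : T = T'.
    by apply: (contractible_eq (r := a) cT cT'); [rewrite TE; left; left|rewrite aE; apply: fT].
  by move: ab bc; rewrite TT' -aE; lia.
have vF : {subset v <= unzip1 F}.
  move=> l /(mem_lroots R G)[r0 lr0]; have [/DP[T cT r0E]|r0D] := boolP (r0 \in D).
    have [i [j [a [b [[_ [_ _ lc] _ _] aF]]]]] := keptP T cT.
    by rewrite r0E in lr0; rewrite (lroots_fun rv lr0 lc); apply/mapP; exists (i, a).
  by apply/mapP; exists (l, r0); rewrite // mem_filter /= r0D.
(* content maximality: the remaining letters cover the support and are as many *)
have uF : uniq (unzip1 F).
  have [_ cm] := cmw.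
  have supE : #|cox_supp w| = size (undup v).
    rewrite (cox_supp_reducedb R rv vw) cardsE -(card_uniqP (undup_uniq v)).
    by apply: eq_card => x; rewrite mem_undup.
  have szF : size (undup v) = size F.
    move: cm; rewrite supE (cox_length_reducedb rv vw) -sD -sF PoszD addrK => -[->//].
  apply: contraT; rewrite -ltn_size_undup size_map -szF ltnNge.
  case/negP; apply: uniq_leq_size; first exact: undup_uniq.
  by move=> l; rewrite !mem_undup; apply: vF.
(* an erased root is represented by the first root of its triple *)
have kept l r0 : (l, r0) \in lroots v -> exists2 r1, (l, r1) \in F &
    r0 = r1 \/ exists T, [/\ CT T, r0 = f T & T r1].
  move=> lr0; have [/DP[T cT r0E]|r0D] := boolP (r0 \in D).
    have [i [j [a [b [[[_ TE] [_ _ lc] _ _] aF]]]]] := keptP T cT.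
    rewrite r0E in lr0; rewrite (lroots_fun rv lr0 lc); exists a => //; right; exists T; split=> //.
    by rewrite TE; left; left.
  by exists r0; [rewrite mem_filter /= r0D|left].
move=> kr kr' rr'; have [r1 r1F h1] := kept _ _ kr; have [r2 r2F h2] := kept _ _ kr'.
have r12 : r1 = r2.
  by have [] : (k, r1) = (k, r2) by apply: (uniq_map_inj uF).
rewrite -{}r12 in h2; case: h1 h2 => [rE|[T [cT rE Tr1]]] [r'E|[T' [cT' r'E T'r1]]].
- by rewrite rE r'E eqxx in rr'.
- by exists T'; split=> //; rewrite ?rE // r'E; apply: fT.
- by exists T; split=> //; rewrite ?r'E // rE; apply: fT.
by rewrite rE r'E (contractible_eq cT cT' Tr1 T'r1) eqxx in rr'.
Qed.

Lemma letter_triple T i j a b c k r : CT T -> split_triple v T i j a b c -> T r ->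
  (k, r) \in lroots v -> (k = i /\ (r = a \/ r = c)) \/ (k = j /\ r = b).
Proof.
move=> cT [[_ ->] [la lb lc] _ _] [[->|->]|->] kr; [left|right|left].
- by split; [exact: lroots_fun rv kr la|left].
- by split; first exact: lroots_fun rv kr lb.
by split; [exact: lroots_fun rv kr lc|right].
Qed.

Lemma split_neq T i j a b c : split_triple v T i j a b c -> [/\ i != j, a != b, b != c & a != c].
Proof.
move=> [[Gij _] _ /andP[ab bc] _]; split; first exact: (adj_neq irrG Gij).
- by apply: contraTneq ab => ->; rewrite ltnn.
- by apply: contraTneq bc => ->; rewrite ltnn.
by apply: contraTneq (ltn_trans ab bc) => ->; rewrite ltnn.
Qed.

Lemma repeated_letter k r r' : (k, r) \in lroots v -> (k, r') \in lroots v ->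
  (index r (vroots v) < index r' (vroots v))%N ->
  exists T i j b, CT T /\ split_triple v T i j r b r' /\ k = i.
Proof.
move=> kr kr' lt; have rr' : r != r' by apply: contraTneq lt => ->; rewrite ltnn.
have [T [cT Tr Tr']] := same_letter_contractible kr kr' rr'.
have [i [j [a [b [c sT]]]]] := split_triple_exists fb cT rv vw.
have [ij ab bc ac] := split_neq sT.
have [_ _ /andP[iab ibc] _] := sT; have iac := ltn_trans iab ibc.
exists T, i, j, b; split=> //.
case: (letter_triple cT sT Tr kr) (letter_triple cT sT Tr' kr') =>
  [[ki [rE|rE]]|[kj rE]] [[ki' [rE'|rE']]|[kj' rE']];
  try (by rewrite rE rE' ltnn in lt);
  try (by rewrite -?ki -?kj -?ki' -?kj' ?eqxx in ij).
  by rewrite rE rE'.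
by rewrite rE rE' in lt; have := ltn_trans lt iac; rewrite ltnn.
Qed.

(** Two triples sharing a letter coincide: that letter would otherwise label roots
in both, and [same_letter_contractible] puts these roots in a common triple. *)
Lemma same_triple T T' i j a b c i' j' a' b' c' k : CT T -> CT T' ->
  split_triple v T i j a b c -> split_triple v T' i' j' a' b' c' ->
  k \in [:: i; j] -> k \in [:: i'; j'] -> T = T'.
Proof.
move=> cT cT' sT sT'; rewrite !inE => kij kij'.
have ex U p q x y z : split_triple v U p q x y z -> (k == p) || (k == q) ->
    exists2 r, U r & (k, r) \in lroots v.
  move=> [[_ ->] [lx ly _] _ _] /orP[]/eqP->; first by exists x => //; left; left.
  by exists y => //; left; right.
have [r Tr kr] := ex _ _ _ _ _ _ sT kij; have [r' Tr' kr'] := ex _ _ _ _ _ _ sT' kij'.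
have [rr'|rr'] := eqVneq r r'; first by rewrite -rr' in Tr'; apply: contractible_eq Tr Tr'.
have [U [cU Ur Ur']] := same_letter_contractible kr kr' rr'.
by rewrite (contractible_eq cT cU Tr Ur) (contractible_eq cT' cU Tr' Ur').
Qed.

Lemma nth_lroots (i0 : 'I_n) m : (m < size v)%N -> (nth i0 v m, nth 0 (vroots v) m) \in lroots v.
Proof.
move=> mv; have := mem_nth (i0, 0) (n := m) (s := lroots v); rewrite size_lroots => /(_ mv).
have -> : nth (i0, 0) (lroots v) m = (nth i0 v m, nth 0 (vroots v) m); last by [].
rewrite /vroots (nth_map (i0, 0)) ?size_lroots // -{2}(unzip1_lroots R G v) (nth_map (i0, 0)) ?size_lroots //.
by case: (nth _ _ _).
Qed.

Lemma subseq_triple i j : G i j -> subseq [:: i; j; i] v ->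
  exists T a b c, CT T /\ split_triple v T i j a b c.
Proof.
move=> Gij /subseq3_split[x [y [z [t vE]]]].
pose m1 := size x; pose m2 := (m1 + (size y).+1)%N; pose m3 := (m2 + (size z).+1)%N.
have sv : size v = (m3 + (size t).+1)%N.
  by rewrite vE !size_cat /= !size_cat /= !size_cat /= /m3 /m2 /m1 -!addnA !addSn.
have n1 : nth i v m1 = i by rewrite vE nth_cat ltnn subnn.
have n2 : nth i v m2 = j.
  by rewrite vE nth_cat ltnNge leq_addr /= addKn /= nth_cat ltnn subnn.
have n3 : nth i v m3 = i.
  rewrite vE nth_cat ltnNge /m3 /m2 -addnA leq_addr /= addKn addSn /= nth_cat.
  by rewrite ltnNge leq_addr /= addKn /= nth_cat ltnn subnn.
have h1 : (m1 < m2)%N by rewrite /m2 addnS ltnS leq_addr.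
have h2 : (m2 < m3)%N by rewrite /m3 addnS ltnS leq_addr.
have h3 : (m3 < size v)%N by rewrite sv addnS ltnS leq_addr.
have v2 := ltn_trans h2 h3; have v1 := ltn_trans h1 v2.
have e1 := nth_lroots i v1; have e2 := nth_lroots i v2; have e3 := nth_lroots i h3.
rewrite n1 n2 n3 in e1 e2 e3; have ur := uniq_vroots R rv.
have idx m : (m < size v)%N -> index (nth 0 (vroots v) m) (vroots v) = m.
  by move=> mv; rewrite index_uniq // size_vroots.
have [|T [i' [j' [b [cT [sT ii']]]]]] := repeated_letter e1 e3.
  by rewrite !idx // (ltn_trans h1 h2).
rewrite -ii' in sT; exists T, (nth 0 (vroots v) m1), b, (nth 0 (vroots v) m3).
have [_ [_ lb _] _ out] := sT; have [be|be] := eqVneq (nth 0 (vroots v) m2) b.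
  by rewrite -be in lb; rewrite (lroots_fun rv e2 lb).
have := out _ _ e2 Gij be; rewrite !idx // => -[h|h].
  by have := ltn_trans h h1; rewrite ltnn.
by have := ltn_trans h h2; rewrite ltnn.
Qed.

Lemma matched_triple i j : matched v i j -> exists T p q a b c,
  [/\ CT T, split_triple v T p q a b c & (p, q) = (i, j) \/ (p, q) = (j, i)].
Proof.
case/andP=> Gij /orP[] su.
  by have [T [a [b [c [cT sT]]]]] := subseq_triple Gij su; exists T, i, j, a, b, c; split=> //;
    left.
have Gji : G j i by rewrite adj_sym.
by have [T [a [b [c [cT sT]]]]] := subseq_triple Gji su; exists T, j, i, a, b, c; split=> //; right.
Qed.

Lemma count_lroots k (s : seq V) : uniq s -> (forall r, ((k, r) \in lroots v) = (r \in s)) ->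
  count_mem k v = size s.
Proof.
move=> us sP; rewrite -{1}(unzip1_lroots R G v) count_map -size_filter.
rewrite -(size_map (pair k) s); apply/perm_size/uniq_perm.
- exact/filter_uniq/uniq_lroots.
- by rewrite map_inj_uniq // => x y [].
move=> [l r]; rewrite mem_filter /=; apply/andP/mapP => [[/eqP-> kr]|[x xs [-> ->]]].
  by exists r; rewrite // -sP.
by rewrite eqxx sP.
Qed.

Lemma split_count T i j a b c : CT T -> split_triple v T i j a b c ->
  count_mem i v = 2%N /\ count_mem j v = 1%N.
Proof.
move=> cT sT; have [ij ab bc ac] := split_neq sT.
have [[_ TE] [la lb lc] _ _] := sT.
have [Ta Tb Tc] : [/\ T a, T b & T c] by rewrite TE; split; [left; left|left; right|right].
have inT k r r' : (k, r) \in lroots v -> (k, r') \in lroots v -> T r -> T r'.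
  move=> kr kr' Tr; have [<-//|rr'] := eqVneq r r'.
  have [U [cU Ur Ur']] := same_letter_contractible kr kr' rr'.
  by rewrite (contractible_eq cT cU Tr Ur).
split.
  apply: (@count_lroots _ [:: a; c]) => [|r]; first by rewrite /= inE ac.
  rewrite !inE; apply/idP/orP => [ir|[]/eqP->//].
  case: (letter_triple cT sT (inT _ _ _ la ir Ta) ir) => [[_ [->|->]]|[ijE _]].
  - by left.
  - by right.
  by rewrite ijE eqxx in ij.
apply: (@count_lroots _ [:: b]) => // r.
rewrite inE; apply/idP/eqP => [jr|->//].
case: (letter_triple cT sT (inT _ _ _ lb jr Tb) jr) => [[jiE _]|[_ //]].
by rewrite jiE eqxx in ij.
Qed.

(** A matched pair comes from a contractible triple ([matched_triple]), and
so does a repeated letter ([repeated_letter]); as different triples have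
disjoint letters, the conditions of goodness follow. *)
Theorem content_maximal_good : good v.
Proof.
split=> [i j k Mij Mik|i j Mij|i nM].
- have [Gij _] := andP Mij; have [Gik _] := andP Mik.
  have [T [p [q [a [b [c [cT sT pq]]]]]]] := matched_triple Mij.
  have [T' [p' [q' [a' [b' [c' [cT' sT' pq']]]]]]] := matched_triple Mik.
  have ip : i \in [:: p; q] by rewrite !inE; case: pq => -[-> ->]; rewrite eqxx ?orbT.
  have ip' : i \in [:: p'; q'] by rewrite !inE; case: pq' => -[-> ->]; rewrite eqxx ?orbT.
  have TT' := same_triple cT cT' sT sT' ip ip'.
  rewrite -{cT'}TT' in sT'.
  have ji := adj_neq irrG Gij; have ki := adj_neq irrG Gik.
  have [_ [la lb lc] _ _] := sT'.
  have [[_ TE'] _ _ _] := sT'.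
  have [Ta Tb Tc] : [/\ T a', T b' & T c'] by rewrite TE'; split; [left; left|left; right|right].
  have kin : k \in [:: p; q].
    rewrite !inE; case: pq' => -[p'E q'E]; rewrite p'E q'E in la lb.
      by case: (letter_triple cT sT Tb lb) => [[->]|[->]]; rewrite eqxx ?orbT.
    by case: (letter_triple cT sT Ta la) => [[->]|[->]]; rewrite eqxx ?orbT.
  move: kin; rewrite !inE; case: pq => -[-> ->] /orP[]/eqP kE //;
  by rewrite kE eqxx in ki.
- have [T [p [q [a [b [c [cT sT pq]]]]]]] := matched_triple Mij.
  have [cp cq] := split_count cT sT.
  by case: pq => -[pE qE]; rewrite pE in cp; rewrite qE in cq; rewrite cp cq.
rewrite leqNgt; apply/negP => c2.
have [r [r' [ir ir' lt]]] : exists r r', [/\ (i, r) \in lroots v, (i, r') \in lroots v &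
    (index r (vroots v) < index r' (vroots v))%N].
  have iv : i \in v by rewrite -has_pred1 has_count (ltn_trans _ c2).
  have /subseq_cons_split[p [q [vE ip _]]] : subseq [:: i] v by rewrite sub1seq.
  have iq : i \in q.
    move: c2; rewrite vE count_cat (count_memPn ip) /= eqxx add0n add1n ltnS -has_count.
    by rewrite has_pred1.
  case/splitPr: iq vE => y z vE.
  have sv : size v = (size p + (size y).+1 + (size z).+1)%N.
    by rewrite vE !size_cat /= size_cat /= -!addnA !addSn.
  have n1 : nth i v (size p) = i by rewrite vE nth_cat ltnn subnn.
  have n2 : nth i v (size p + (size y).+1) = i.
    by rewrite vE nth_cat ltnNge leq_addr /= addKn /= nth_cat ltnn subnn.
  have h2 : (size p + (size y).+1 < size v)%N by rewrite sv (addnS (_ + _)) ltnS leq_addr.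
  have h1 : (size p < size v)%N by apply: leq_ltn_trans h2; apply: leq_addr.
  exists (nth 0 (vroots v) (size p)), (nth 0 (vroots v) (size p + (size y).+1)).
  have := nth_lroots i h1; have := nth_lroots i h2; rewrite n1 n2 => e2 e1; split=> //.
  by rewrite !index_uniq ?size_vroots ?uniq_vroots // addnS ltnS leq_addr.
have [T [p [q [b [cT [sT ipE]]]]]] := repeated_letter ir ir' lt.
have [[Gpq _] [lr lb lr'] /andP[rb br'] _] := sT.
have /negP[] := nM q; rewrite /matched ipE Gpq /=; apply/orP; left.
have rin x : x \in vroots v ->
  (index x (vroots v) < size v)%N by rewrite -(size_vroots R G v) index_mem.
have nthv k x : (k, x) \in lroots v -> nth p v (index x (vroots v)) = k.
  move=> kx; have xin := lroots_vroots kx.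
  by have := nth_lroots p (rin _ xin); rewrite nth_index // => /(lroots_fun rv kx) ->.
have := subseq_drop3 p rb br' (rin _ (lroots_vroots lr')).
by rewrite (nthv _ _ lr) (nthv _ _ lb) (nthv _ _ lr').
Qed.

End Final.
End ContentMaximalIsGood.

(** * Counting content maximal elements *)

Section Bijection.
Variables (R : realType) (n : nat) (G : coxgraph n) (vs : seq ('I_n * option 'I_n)).
Hypotheses (leaf_vs : leaf_order G vs) (all_vs : forall i, i \in unzip1 vs).
Local Notation word := (cox_word G).
Local Notation symG := (@adj_sym n G).
Local Notation irrG := (@adj_irr n G).

(** Reversal preserves goodness, which reconciles the words of [enum_good]
with the reversed words of the preceding parts. *)
Lemma content_maximalP w :
  content_maximal R w <-> w \in [seq word z.1 | z <- enum_good vs].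
Proof.
split=> [cmw|/mapP[z zin ->]].
  have [u uw ru] := reducedb_exists w; rewrite -uw in cmw *.
  have gr : good G (rev u).
    by apply: content_maximal_good cmw _ _; rewrite ?reducedb_rev ?revK.
  have gu := good_rev gr; rewrite revK in gu.
  have [z zin uz] := enum_good_complete symG irrG leaf_vs gu (fun i _ => all_vs i).
  by apply/mapP; exists z => //; apply: cox_word_braid_eq.
have [gz _ _] := enum_good_wf symG irrG leaf_vs zin.
by apply: good_content_maximal (good_rev gz) _; rewrite revK.
Qed.

Lemma uniq_words : uniq [seq word z.1 | z <- enum_good vs].
Proof.
apply: (uniq_phi_enum_good symG irrG _ _ leaf_vs) => [u u' gu gu'|v c u u'].
  by apply: (matsumoto R); apply: (good_reducedb R).
by rewrite /flank !cox_word_cat => /mulgI/mulIg.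
Qed.

Lemma finite_content_maximal : finite_set (content_maximal_set R G).
Proof.
apply: (@sub_finite_set _ _ [set` [seq word z.1 | z <- enum_good vs]]); last exact: finite_seq.
by move=> w /content_maximalP.
Qed.

Lemma ncontent_maximalE : ncontent_maximal R G = size (enum_good vs).
Proof.
rewrite -(size_map (fun z => word z.1)); apply: card_fset_set_seq; first exact: uniq_words.
exact: content_maximalP.
Qed.
End Bijection.

Section Chains.
Local Open Scope nat_scope.
Variables (e : rel nat) (e_irr : irreflexive e).

Definition sym_closure : rel nat := fun i j => e i j || e j i.
Local Notation es := sym_closure.

(** A forest [base] on the vertices below [b], to whose last vertex b - 1 the path
b, b + 1, ... is attached. *)
Record chain_base (b : nat) (base : seq (nat * option nat)) : Prop := ChainBase {
  base_leaf : leaf_order es base;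
  base_mem : forall x, (x \in unzip1 base) = (x < b);
  base_parent : all (fun v => if v.2 is Some p then p < b else true) base;
  base_gt0 : 0 < b;
  tail_adj : forall v x, b <= v -> x < v -> es v x = (v == x.+1) }.

Variables (b : nat) (base : seq (nat * option nat)).
Hypothesis cb : chain_base b base.

Fixpoint chain k : seq (nat * option nat) :=
  if k is k'.+1 then (b + k', Some (b + k').-1) :: chain k' else base.

Lemma chain_mem k x : (x \in unzip1 (chain k)) = (x < b + k).
Proof.
elim: k => [|k IH] /=; first by rewrite (base_mem cb) addn0.
by rewrite inE IH addnS ltnS [RHS]leq_eqVlt.
Qed.

Lemma chain_leaf k : leaf_order es (chain k).
Proof.
elim: k => [|k IH] /=; first exact: base_leaf cb.
rewrite IH chain_mem ltnn andbT /=.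
apply/allP => x; rewrite chain_mem => xk; rewrite (tail_adj cb) ?leq_addr //.
by apply/eqP; apply/eqP/eqP => [->//|[<-]]; rewrite prednK // addn_gt0 (base_gt0 cb).
Qed.

Lemma chain_parent k : all (fun v => if v.2 is Some p then p < b + k else true) (chain k).
Proof.
elim: k => [|k IH] /=; first by rewrite addn0; apply: base_parent cb.
apply/andP; split; first by rewrite addnS ltnS leq_pred.
by apply: sub_all IH => -[v [p|]] //= /leq_trans; apply; rewrite leq_add2l.
Qed.

Lemma ord_chain n vs : all (fun v => v.1 < n) vs ->
  all (fun v => if v.2 is Some p then p < n else true) vs ->
  exists vs' : seq ('I_n * option 'I_n), map_vs (@nat_of_ord n) vs' = vs.
Proof.
elim: vs => [|[v op] vs IH] /=; first by exists [::].
move=> /andP[vn vsn] /andP[opn opsn]; have [vs' <-] := IH vsn opsn.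
case: op opn => [p|] pn; first by exists ((Ordinal vn, Some (Ordinal pn)) :: vs').
by exists ((Ordinal vn, None) :: vs').
Qed.

Lemma chain_count (R : realType) k :
  finite_set (content_maximal_set R (edge_graph e_irr (b + k))) /\
  ncontent_maximal R (edge_graph e_irr (b + k)) = size (enum_good (chain k)).
Proof.
have mem_lt : all (fun v => v.1 < b + k) (chain k).
  apply/allP => v vin; rewrite -chain_mem; exact: map_f.
have [vs vsE] := ord_chain mem_lt (chain_parent k).
have leaf_vs : leaf_order (edge_graph e_irr (b + k)) vs.
  by rewrite -(@leaf_order_map _ _ _ _ es (@ord_inj (b + k))) // vsE chain_leaf.
have all_vs i : i \in unzip1 vs.
  by rewrite -(mem_map (@ord_inj (b + k))) -unzip1_map_vs vsE chain_mem.
split; first exact: finite_content_maximal leaf_vs all_vs.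
by rewrite (ncontent_maximalE R leaf_vs all_vs) -(size_enum_good_map (@ord_inj (b + k))) vsE.
Qed.

Lemma chain_rec k :
  size (enum_good (chain k.+3)) + size (enum_good (chain k)) =
  3 * size (enum_good (chain k.+2)) + size (enum_good (chain k.+1)).
Proof.
have es_sym : symmetric es by move=> i j; rewrite /es orbC.
have es_irr : irreflexive es by move=> i; rewrite /es e_irr.
have E m : (b + m.+1).-1 = b + m by rewrite addnS.
have C2 : chain k.+2 = [:: (b + k.+1, Some (b + k)), (b + k, Some (b + k).-1) & chain k].
  by rewrite -[chain k.+2]/((b + k.+1, Some (b + k.+1).-1) :: chain k.+1) E.
have C3 : chain k.+3 = (b + k.+2, Some (b + k.+1)) :: chain k.+2.
  by rewrite -[chain k.+3]/((b + k.+2, Some (b + k.+2).-1) :: chain k.+2) E.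
rewrite C3 C2; apply: (size_enum_good_rec es_sym es_irr).
by rewrite -C2; apply: chain_leaf.
Qed.
End Chains.

(** * Generating functions *)

Definition denom : {poly int} := 1 - 3 *: 'X - 'X^2 + 'X^3.

(** The coefficients of [denom] vanish beyond degree 3. *)
Lemma denom_conv (g : nat -> int) m :
  let gs d := if (d <= m)%N then g (m - d)%N else 0 in
  \sum_(k < m.+1) denom`_(m - k) * g k = gs 0%N - 3 * gs 1%N - gs 2%N + gs 3%N.
Proof.
have dE k : denom`_k = if k is k'.+1 then if k' is k''.+1 then
    if k'' is k3.+1 then (k3 == 0%N)%:R else -1 else -3 else 1.
  by rewrite /denom !coefE; case: k => [|[|[|[|k]]]] //=; rewrite ?mulr0 ?subr0.
case: m => [|[|[|m]]] gs; rewrite /gs /=.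
- by rewrite big_ord_recr big_ord0 /= dE; ring.
- by rewrite !big_ord_recr big_ord0 /= !dE /=; ring.
- by rewrite !big_ord_recr big_ord0 /= !dE /=; ring.
rewrite 4!big_ord_recr big1 /= => [|k _].
  have [-> -> -> ->] : [/\ m.+3 - m.+3 = 0, m.+3 - m.+2 = 1, m.+3 - m.+1 = 2 & m.+3 - m = 3]%N.
    by split; lia.
  have [-> -> -> ->] : [/\ m.+3 - 0 = m.+3, m.+3 - 1 = m.+2, m.+3 - 2 = m.+1 & m.+3 - 3 = m]%N.
    by split; lia.
  by rewrite !dE /=; ring.
rewrite dE; case: k => k km /=.
have -> : (m.+3 - k = (m - k.+1).+4)%N by lia.
by rewrite mul0r.
Qed.

(** A sequence satisfying the recurrence is determined by three values, which
give the three coefficients of the numerator. *)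
Lemma ogf_chain n0 (f F : nat -> nat) (P : {poly int}) :
  (forall k, f (n0 + k)%N = F k) ->
  (forall k, F k.+3 + F k = 3 * F k.+2 + F k.+1)%N ->
  (forall k, (k < n0)%N -> P`_k = 0) ->
  (forall k, P`_(n0 + k) = match k with
     | 0%N => (F 0%N)%:Z | 1%N => (F 1%N)%:Z - 3 * (F 0%N)%:Z
     | 2%N => (F 2%N)%:Z - 3 * (F 1%N)%:Z - (F 0%N)%:Z | _ => 0 end) ->
  ogf n0 f =1 fps_quo P denom.
Proof.
move=> fF Frec P0 PE; apply/fps_quoP; first by rewrite /denom !coefE.
move=> m; rewrite denom_conv.
have gsmall k : (k < n0)%N -> ogf n0 f k = 0 by move=> kn; rewrite /ogf leqNgt kn.
have gF k : ogf n0 f (n0 + k) = (F k)%:Z by rewrite /ogf leq_addr fF.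
have [mn|nm] := ltnP m n0.
  rewrite !gsmall ?P0 //; try exact: leq_ltn_trans (leq_subr _ _) mn.
  by case: ifP => _; case: ifP => _; case: ifP => _.
have -> : m = (n0 + (m - n0))%N by rewrite subnKC.
move: (m - n0)%N => k {m nm}; rewrite PE.
have gs0 d : (k < d)%N -> (if (d <= n0 + k)%N then ogf n0 f (n0 + k - d) else 0) = 0.
  move=> kd; case: ifP => // dk; apply: gsmall; lia.
have gs1 d : (d <= k)%N -> (if (d <= n0 + k)%N then ogf n0 f (n0 + k - d) else 0) = (F (k - d)%N)%:Z.
  by move=> dk; rewrite (leq_trans dk (leq_addl _ _)) -addnBA // gF.
case: k gs0 gs1 => [|[|[|k]]] gs0 gs1.
- by rewrite (gs1 0%N) // !gs0 //=; ring.
- by rewrite (gs1 0%N) // (gs1 1%N) // !gs0 //=; ring.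
- by rewrite (gs1 0%N) // (gs1 1%N) // (gs1 2%N) // !gs0 //=; ring.
rewrite (gs1 0%N) // (gs1 1%N) // (gs1 2%N) // (gs1 3%N) //.
have -> : (k.+3 - 0 = k.+3)%N by []. have -> : (k.+3 - 1 = k.+2)%N by [].
have -> : (k.+3 - 2 = k.+1)%N by rewrite subn2. have -> : (k.+3 - 3 = k)%N by rewrite -addn3 addnK.
by have := Frec k; lia.
Qed.

Section ChainSeries.
Variables (R : realType) (e : rel nat) (e_irr : irreflexive e) (b : nat).
Variable base : seq (nat * option nat).
Hypothesis cb : chain_base e b base.
Let f n := ncontent_maximal R (edge_graph e_irr n).
Let F k := size (enum_good (chain b base k)).

Lemma chain_values k : f (b + k) = F k.
Proof. by have [] := chain_count e_irr cb R k. Qed.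

Lemma chain_finite n : (b <= n)%N -> finite_set (content_maximal_set R (edge_graph e_irr n)).
Proof. by move=> bn; rewrite -(subnKC bn); have [] := chain_count e_irr cb R (n - b). Qed.

Lemma chain_series (P : {poly int}) :
  (forall k, (k < b)%N -> P`_k = 0) ->
  (forall k, P`_(b + k) = match k with
     | 0%N => (F 0%N)%:Z | 1%N => (F 1%N)%:Z - 3 * (F 0%N)%:Z
     | 2%N => (F 2%N)%:Z - 3 * (F 1%N)%:Z - (F 0%N)%:Z | _ => 0 end) ->
  ogf b f =1 fps_quo P denom.
Proof.
move=> P0 PE; apply: ogf_chain P0 PE; first exact: chain_values.
by move=> k; apply: (chain_rec e_irr).
Qed.
End ChainSeries.

Lemma branch_tail c b v x : (1 < b)%N -> (c < b)%N -> (b <= v)%N -> (x < v)%N ->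
  edge_branch c v x || edge_branch c x v = (v == x.+1).
Proof.
move=> b1 cb bv xv; rewrite /edge_branch; case: v bv xv => [|v] bv xv; first lia.
have -> : (x == v.+2) = false by lia.
by case: x xv => //= _; lia.
Qed.

Definition baseA : seq (nat * option nat) := [:: (0, None)]%N.
(** The vertices are listed from the last one added to the first one. *)
Definition baseD : seq (nat * option nat) :=
  [:: (3, Some 2); (0, Some 2); (1, Some 2); (2, None)]%N.
Definition baseE : seq (nat * option nat) :=
  [:: (5, Some 4); (4, Some 3); (0, Some 3); (1, Some 2); (2, Some 3); (3, None)]%N.

Lemma chain_baseA : chain_base edgeA 1 baseA.
Proof. by split=> // [x|v x]; [case: x|rewrite /sym_closure /edgeA; lia]. Qed.

Lemma chain_baseD : chain_base (edge_branch 2) 4 baseD.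
Proof. by split=> // [x|v x]; [case: x => [|[|[|[|x]]]]|exact: branch_tail]. Qed.

Lemma chain_baseE : chain_base (edge_branch 3) 6 baseE.
Proof. by split=> // [x|v x]; [case: x => [|[|[|[|[|[|x]]]]]]|exact: branch_tail]. Qed.

Theorem theorem4p2 (R : realType) :
  let fA (n : nat) := ncontent_maximal R (graphA n) in
  let fD (n : nat) := ncontent_maximal R (graphD n) in
  let fE (n : nat) := ncontent_maximal R (graphE n) in
  let Q : {poly int} := 1 - 3 *: 'X - 'X^2 + 'X^3 in
  [/\ (forall n : nat, (1 <= n)%N ->
         finite_set (content_maximal_set R (graphA n))),
      ogf 1 fA =1 fps_quo (2 *: 'X - 'X^3) Q &
      [seq fA n | n <- iota 1 5] = [:: 2; 6; 19; 61; 196]%N]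
  /\
  [/\ (forall n : nat, (4 <= n)%N ->
         finite_set (content_maximal_set R (graphD n))),
      ogf 4 fD =1 fps_quo (62 *: 'X^4 + 15 *: 'X^5 - 19 *: 'X^6) Q &
      [seq fD n | n <- iota 4 4] = [:: 62; 201; 646; 2077]%N]
  /\
  [/\ (forall n : nat, (6 <= n)%N ->
         finite_set (content_maximal_set R (graphE n))),
      ogf 6 fE =1 fps_quo (652 *: 'X^6 + 140 *: 'X^7 - 201 *: 'X^8) Q &
      [seq fE n | n <- iota 6 3] = [:: 652; 2096; 6739]%N].
Proof.
move=> fA fD fE Q.
have valA k : fA (1 + k)%N = size (enum_good (chain 1 baseA k)) := chain_values R _ chain_baseA k.
have valD k : fD (4 + k)%N = size (enum_good (chain 4 baseD k)) := chain_values R _ chain_baseD k.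
have valE k : fE (6 + k)%N = size (enum_good (chain 6 baseE k)) := chain_values R _ chain_baseE k.
split; last split; split.
- exact: (chain_finite R _ chain_baseA).
- apply: (chain_series R _ chain_baseA) => k.
    by case: k => // _; rewrite !coefE.
  have [-> -> ->] : [/\ size (enum_good (chain 1 baseA 0)) = 2%N,
    size (enum_good (chain 1 baseA 1)) = 6%N & size (enum_good (chain 1 baseA 2)) = 19%N] by [].
  by case: k => [|[|[|k]]]; rewrite !coefE.
- by rewrite /= (valA 0%N) (valA 1%N) (valA 2%N) (valA 3%N) (valA 4%N).
- exact: (chain_finite R _ chain_baseD).
- apply: (chain_series R _ chain_baseD) => k.
    by case: k => [|[|[|[|k]]]] // _; rewrite !coefE.
  have [-> -> ->] : [/\ size (enum_good (chain 4 baseD 0)) = 62%N,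
    size (enum_good (chain 4 baseD 1)) = 201%N & size (enum_good (chain 4 baseD 2)) = 646%N].
    by split; vm_compute.
  by case: k => [|[|[|k]]]; rewrite !coefE.
- rewrite /= (valD 0%N) (valD 1%N) (valD 2%N) (valD 3%N); vm_compute; reflexivity.
- exact: (chain_finite R _ chain_baseE).
- apply: (chain_series R _ chain_baseE) => k.
    by case: k => [|[|[|[|[|[|k]]]]]] // _; rewrite !coefE.
  have [-> -> ->] : [/\ size (enum_good (chain 6 baseE 0)) = 652%N,
    size (enum_good (chain 6 baseE 1)) = 2096%N & size (enum_good (chain 6 baseE 2)) = 6739%N].
    by split; vm_compute.
  by case: k => [|[|[|k]]]; rewrite !coefE.
rewrite /= (valE 0%N) (valE 1%N) (valE 2%N); vm_compute; reflexivity.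
Qed.
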